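(* Let $\mathbb F$ be $\mathbb R$ or $\mathbb C$, and let $I,K,R$ be positive integers such that $$2\leq K\leq I\leq R,\qquad R\leq \frac{K+3I-1-\sqrt{(K-I)^2+2K+6I-3}}{2},$$ or equivalently $$m-1\leq K\leq I\leq R,\qquad R\leq (I+1-m)(K+1-m),$$ where $m=R-I+2$. Then the SFS-CPD of an $I\times I\times K$ tensor of SFS-rank $R$ (over $\mathbb F$) is generically unique.
   Context: An SFS-tensor is a tensor $\mathcal T=(t_{ijk})\in\mathbb F^{I\times I\times K}$ whose frontal slices $(t_{ijk})_{i,j}$ are symmetric matrices for every $k$. A rank-1 SFS-tensor is one of the form $\mathbf a\circ\mathbf a\circ\mathbf c$ with nonzero $\mathbf a\in\mathbb F^I$, $\mathbf c\in\mathbb F^K$, where $\circ$ is the outer product, i.e. its entries are $a_ia_jc_k$. For $\mathbf A=[\mathbf a_1\ \dots\ \mathbf a_R]\in\mathbb F^{I\times R}$ and $\mathbf C=[\mathbf c_1\ \dots\ \mathbf c_R]\in\mathbb F^{K\times R}$ write $[\mathbf A,\mathbf A,\mathbf C]_R=\sum_{r=1}^R\mathbf a_r\circ\mathbf a_r\circ\mathbf c_r$. The SFS-rank of an SFS-tensor $\mathcal T$ is the minimal number of rank-1 SFS-tensors (over $\mathbb F$) whose sum is $\mathcal T$; a decomposition of $\mathcal T$ into this minimal number of rank-1 SFS-terms is called an SFS-CPD of $\mathcal T$. The SFS-CPD of $\mathcal T$ is unique if it is only subject to permutation of the rank-1 terms and to rescaling of the vectors within a rank-1 term that leaves the term unchanged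 (i.e. the collection of rank-1 SFS-terms is uniquely determined up to order). Let $\mu_{\mathbb F}$ be the Lebesgue measure on $\mathbb F^{I\times R}\times\mathbb F^{K\times R}$. The SFS-CPD of an $I\times I\times K$ tensor of SFS-rank $R$ is generically unique if $$\mu_{\mathbb F}\{(\mathbf A,\mathbf C):\ \text{the SFS-CPD of the tensor } [\mathbf A,\mathbf A,\mathbf C]_R \text{ is not unique}\}=0.$$ *)

(* Defs.v *)
From HB Require Import structures.
From mathcomp Require Import all_boot all_order all_algebra.
From mathcomp Require Import all_classical all_reals all_analysis.
From mathcomp Require Import complex.

Set Implicit Arguments.
Unset Strict Implicit.
Unset Printing Implicit Defensive.

Import Order.TTheory GRing.Theory Num.Theory.

Local Open Scope classical_set_scope.
Local Open Scope ring_scope.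

Section Tensors.
Variable F : fieldType.

Definition tensor (I J K : nat) := {ffun 'I_I * 'I_J * 'I_K -> F}.

Definition frontal_slice I J K (T : tensor I J K) (k : 'I_K) : 'M[F]_(I, J) :=
  \matrix_(i, j) T (i, j, k).

Definition is_SFS I K (T : tensor I I K) : Prop :=
  forall k, (frontal_slice T k)^T = frontal_slice T k.

Definition outer3 I J K (a : 'cV[F]_I) (b : 'cV[F]_J) (c : 'cV[F]_K) :
    tensor I J K :=
  [ffun ijk => a ijk.1.1 0 * b ijk.1.2 0 * c ijk.2 0].

Definition polyadic I J K r (A : 'M[F]_(I, r)) (B : 'M[F]_(J, r))
    (C : 'M[F]_(K, r)) : tensor I J K :=
  \sum_(j < r) outer3 (col j A) (col j B) (col j C).

Definition SFS_rank1 I K (T : tensor I I K) : Prop :=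
  exists a : 'cV[F]_I, exists c : 'cV[F]_K,
    [/\ a != 0, c != 0 & T = outer3 a a c].

(* The entries of [s] are the rank-1 tensors themselves, not their factors, so
   the rescaling indeterminacy inside a term is already quotiented out. *)
Definition SFS_decomposition I K (T : tensor I I K)
    (s : seq (tensor I I K)) : Prop :=
  (forall X, X \in s -> SFS_rank1 X) /\ \sum_(X <- s) X = T.

Definition has_SFS_rank I K (T : tensor I I K) (n : nat) : Prop :=
  (exists2 s, SFS_decomposition T s & size s = n) /\
  (forall s, SFS_decomposition T s -> (n <= size s)%N).

Definition SFS_CPD I K (T : tensor I I K) (s : seq (tensor I I K)) : Prop :=
  SFS_decomposition T s /\ has_SFS_rank T (size s).

Definition SFS_CPD_unique I K (T : tensor I I K) : Prop :=
  exists2 s, SFS_CPD T s & forall s', SFS_CPD T s' -> perm_eq s s'.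

Lemma is_SFS_polyadic I K r (A : 'M[F]_(I, r)) (C : 'M[F]_(K, r)) :
  is_SFS (polyadic A A C).
Proof.
move=> k; apply/matrixP => i j; rewrite !mxE !sum_ffunE.
by apply: eq_bigr => l _; rewrite !ffunE /= [_ * col l A j 0]mulrC.
Qed.

End Tensors.

Section ConsMeasure.
Context d (T : measurableType d) (R : realType) (n : nat).
Variables (mu : {sigma_finite_measure set T -> \bar R})
          (nu : {sigma_finite_measure set (n.-tuple T) -> \bar R}).

Definition cons_pair (x : T * n.-tuple T) : n.+1.-tuple T :=
  [tuple of x.1 :: x.2].

Lemma measurable_cons_pair : measurable_fun [set: T * n.-tuple T] cons_pair.
Proof. exact: measurable_cons measurable_fst measurable_snd. Qed.

Definition cons_measure : set (n.+1.-tuple T) -> \bar R :=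
  pushforward (mu \x nu)%E cons_pair.

Let measurable_cons_preimage (A : set (n.+1.-tuple T)) :
  measurable A -> measurable (cons_pair @^-1` A).
Proof.
by move=> mA; rewrite -[X in measurable X]setTI; exact: measurable_cons_pair.
Qed.

Let cons_measure0 : cons_measure set0 = 0%E.
Proof. by rewrite /cons_measure /pushforward preimage_set0 measure0. Qed.

Let cons_measure_ge0 A : (0 <= cons_measure A)%E.
Proof. exact: (measure_ge0 (mu \x nu)%E). Qed.

Let cons_measure_sigma_additive : semi_sigma_additive cons_measure.
Proof.
move=> A mA tA mUA; rewrite /cons_measure /pushforward preimage_bigcup.
apply: (measure_semi_sigma_additive (s := (mu \x nu)%E)).
- by move=> i; exact: measurable_cons_preimage.
- apply/trivIsetP => i j _ _ ij; rewrite -preimage_setI.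
  by move/trivIsetP : tA => /(_ _ _ _ _ ij) ->//; rewrite preimage_set0.
- by rewrite -preimage_bigcup; exact: measurable_cons_preimage.
Qed.

HB.instance Definition _ := isMeasure.Build _ _ _ cons_measure
  cons_measure0 cons_measure_ge0 cons_measure_sigma_additive.

Lemma cons_measureX (A : set T) (B : set (n.-tuple T)) :
  measurable A -> measurable B ->
  cons_measure [set x | A (thead x) /\ B [tuple of behead x]] =
  (mu A * nu B)%E.
Proof.
move=> mA mB; rewrite -(product_measure1E mu nu mA mB); congr ((mu \x nu)%E _).
apply/funext => -[x t]; rewrite /preimage/=.
have -> : [tuple of behead (cons_pair (x, t))] = t by exact: val_inj.
by rewrite /thead (tnth_nth x).
Qed.

Let measurable_cons_set (A : set T) (B : set (n.-tuple T)) :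
  measurable A -> measurable B ->
  measurable [set x : n.+1.-tuple T | A (thead x) /\ B [tuple of behead x]].
Proof.
move=> mA mB; apply: measurableI.
- by rewrite -[X in measurable X]setTI; apply: measurable_tnth.
- by rewrite -[X in measurable X]setTI; apply: measurable_behead.
Qed.

Let cons_measure_sigma_finite : sigma_finite setT cons_measure.
Proof.
have /sigma_finiteP[F [TF ndF Foo]] := sigma_finiteT mu.
have /sigma_finiteP[G [TG ndG Goo]] := sigma_finiteT nu.
exists (fun k => [set x | F k (thead x) /\ G k [tuple of behead x]]).
  apply/seteqP; split=> // x _.
  have : setT (thead x) by []. rewrite TF => -[i _ Fi].
  have : setT [tuple of behead x] by []. rewrite TG => -[j _ Gj].
  exists (maxn i j) => //; split.
    by move: Fi; exact/subsetPset/ndF/leq_maxl.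
  by move: Gj; exact/subsetPset/ndG/leq_maxr.
move=> k; have [mF Fk] := Foo k; have [mG Gk] := Goo k; split.
  exact: measurable_cons_set.
by rewrite cons_measureX// lte_mul_pinfty// ge0_fin_numE.
Qed.

HB.instance Definition _ := Measure_isSigmaFinite.Build _ _ _ cons_measure
  cons_measure_sigma_finite.

End ConsMeasure.

Section PowerMeasure.
Context d (T : measurableType d) (R : realType).
Variable mu : {sigma_finite_measure set T -> \bar R}.

(* The [n]-fold product measure mu \x ... \x mu. *)
Fixpoint power_measure n : {sigma_finite_measure set (n.-tuple T) -> \bar R} :=
  match n with
  | 0 => \d_[tuple]
  | n'.+1 => cons_measure mu (power_measure n')
  end.

Lemma measurable_box n (A : 'I_n -> set T) : (forall i, measurable (A i)) ->
  measurable [set x : n.-tuple T | forall i, A i (tnth x i)].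
Proof.
move=> mA.
rewrite (_ : mkset _ = \bigcap_i ((@tnth _ T)^~ i @^-1` A i)); last first.
  apply/seteqP; split=> x Ax i; first by move=> _; exact: Ax.
  exact: (Ax i Logic.I).
apply: fin_bigcap_measurable => // i _; rewrite -[X in measurable X]setTI.
by apply: measurable_tnth => //; exact: mA.
Qed.

Lemma power_measure_box n (A : 'I_n -> set T) : (forall i, measurable (A i)) ->
  power_measure n [set x | forall i, A i (tnth x i)] =
  (\prod_(i < n) mu (A i))%E.
Proof.
elim: n A => [|n IHn] A mA /=.
  by rewrite big_ord0 diracE mem_set//= => -[].
rewrite big_ord_recl -IHn//.
have mB := measurable_box (fun i => mA (lift ord0 i)).
rewrite -(cons_measureX mu (power_measure n) (mA ord0) mB).
congr (cons_measure _ _ _); apply/funext => x; apply/propext; split=> /=.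
  move=> Ax; split=> [|i]; first exact: Ax.
  by rewrite tnth_behead (_ : inord _ = lift ord0 i)//;
    apply: val_inj; rewrite /= inordK// ltnS.
case=> A0 Ax i; case: (unliftP ord0 i) => [j ->|->//].
have := Ax j; rewrite tnth_behead (_ : inord _ = lift ord0 j)//.
by apply: val_inj; rewrite /= inordK// ltnS.
Qed.

End PowerMeasure.

Section GenericUniqueness.
Variable R : realType.

Definition complex_of_pair (z : 2.-tuple (measurableTypeR R)) : R[i] :=
  (tnth z 0 +i* tnth z 1)%C.

(* The coordinates of [x] are the entries of [A] followed by those of [C]. *)
Definition matrix_pair (T : Type) (F : fieldType) (f : T -> F) {I K r : nat}
    (x : (I * r + K * r).-tuple T) : 'M[F]_(I, r) * 'M[F]_(K, r) :=
  (\matrix_(i, j) f (tnth x (lshift (K * r) (mxvec_index i j))),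
   \matrix_(k, j) f (tnth x (rshift (I * r) (mxvec_index k j)))).

(* The product measures live on the Borel sigma-algebra; being negligible
   (contained in a Borel set of measure zero) means having measure zero for the
   completed, i.e. Lebesgue, measure. *)
Definition real_null_set I K r (S : set ('M[R]_(I, r) * 'M[R]_(K, r))) : Prop :=
  (power_measure (@lebesgue_measure R) (I * r + K * r)).-negligible
    (matrix_pair (idfun : measurableTypeR R -> R) @^-1` S).

(* Lebesgue measure on the complex plane is that of R^2. *)
Definition complex_null_set I K r
    (S : set ('M[R[i]]_(I, r) * 'M[R[i]]_(K, r))) : Prop :=
  (power_measure (power_measure (@lebesgue_measure R) 2) (I * r + K * r)).-negligible
    (matrix_pair complex_of_pair @^-1` S).

Definition non_unique_factors (F : fieldType) (I K r : nat) :
    set ('M[F]_(I, r) * 'M[F]_(K, r)) :=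
  [set AC | ~ SFS_CPD_unique (polyadic AC.1 AC.1 AC.2)].

Definition real_generically_unique (I K r : nat) : Prop :=
  real_null_set (@non_unique_factors R I K r).

Definition complex_generically_unique (I K r : nat) : Prop :=
  complex_null_set (@non_unique_factors R[i] I K r).

Definition sqrt_bound (I K r : nat) : Prop :=
  [/\ (2 <= K)%N, (K <= I)%N, (I <= r)%N &
      r%:R <= (K%:R + 3 * I%:R - 1 -
               Num.sqrt ((K%:R - I%:R) ^+ 2 + 2 * K%:R + 6 * I%:R - 3)) / 2 :> R].

End GenericUniqueness.

(* Stated over [int], so that the differences are not truncated. *)
Definition product_bound (I K r : nat) : Prop :=
  let m : int := r%:Z - I%:Z + 2 in
  [/\ m - 1 <= K%:Z, (K <= I)%N, (I <= r)%N &
      r%:Z <= (I%:Z + 1 - m) * (K%:Z + 1 - m)].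

(* Main.v *)
Require Import Defs.
From HB Require Import structures.
From mathcomp Require Import all_classical all_reals all_analysis.
From mathcomp Require Import measurable_realfun complex.
From mathcomp Require Import all_boot all_order all_algebra.
From mathcomp Require Import ring zify.

(** Let [m = r - I + 2].  Contracting [T = \sum_l a_l o a_l o c_l] along a vector
    [x] gives the matrix [A diag(x^T A) C^T], whose rank is at most the number of
    columns of [A] that [x] does not kill.  The same bound holds for every other
    decomposition of [T].  So if conversely the rank is at least
    [min(weight(x^T A), m)] for every [x], then for each competing first factor
    [B] with at most [r] columns, [weight(x^T A) <= weight(x^T B)] whenever
    [weight(x^T B) < m].  When any [I] columns of [A] are independent, Kruskal's
    permutation lemma ([kruskal_permutation]) then says that [B] has exactly [r]
    columns and that they are those of [A] up to order and scaling.  Since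
    [r < 2 I], the matrices [a_l a_l^T] are independent, so the vectors [c_l] are
    recovered as well ([SFS_CPD_unique_polyadic]).

    It remains to see that these hypotheses hold almost everywhere.  Any [I]
    columns of [A] and any [K] columns of [C] are independent off the zero sets
    of finitely many minors, and this gives the rank bound as long as the weight
    is at most [I] ([leq_rank_mul_diag_tr]).  If the weight is at least [I], then
    [D = A diag(x^T A)] has rank [I], so [C D^T] can be any [K x I] matrix, and
    matrices of rank less than [m] have codimension at least
    [(I + 1 - m) (K + 1 - m) >= r >= I] among them.  This exceeds the [I - 1]
    parameters of [x] up to scaling.  Hence the exceptional pairs [(A, C)]
    are covered by the images of finitely many polynomial maps from spaces of
    dimension less than [I r + K r] ([deficient_factors_cover]).

    Instead of a dimension theory for constructible sets, the argument uses that
    more polynomials than there are variables satisfy a nontrivial algebraic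
    relation ([algebraic_dependence]), a consequence of counting monomials.  Each
    such image therefore lies in the zero set of a nonzero polynomial, which is
    null by induction on the number of variables and Fubini's theorem
    ([power_measure_zeros]).  Only this last step distinguishes the real from the
    complex numbers. *)

Set Implicit Arguments.
Unset Strict Implicit.
Unset Printing Implicit Defensive.

Import Order.TTheory GRing.Theory Num.Theory.

Local Open Scope ring_scope.

(** * Vectors annihilating few columns: general position *)

Section GeneralPosition.
Variable F : fieldType.

Definition zeros n (u : 'rV[F]_n) : {set 'I_n} := [set j | u 0 j == 0].

Definition weight n (u : 'rV[F]_n) : nat := #|~: zeros u|.

(** Any [n] columns are independent, in dual form: no nonzero linear form
    vanishes on [n] of them. *)
Definition general_position n r (A : 'M[F]_(n, r)) :=
  forall x : 'rV[F]_n, x != 0 -> (#|zeros (x *m A)| < n)%N.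

Lemma card_zeros n (u : 'rV[F]_n) : (#|zeros u| + weight u = n)%N.
Proof. by rewrite /weight cardsC card_ord. Qed.

Lemma exists_annihilator n m (M : 'M[F]_(n, m)) : (m < n)%N ->
  exists2 x : 'rV[F]_n, x != 0 & x *m M = 0.
Proof.
move=> lt_mn; exists (nz_row (kermx M)).
  rewrite nz_row_eq0 -mxrank_eq0 mxrank_ker -lt0n subn_gt0.
  exact: leq_ltn_trans (rank_leq_col M) lt_mn.
by apply/sub_kermxP; exact: nz_row_sub.
Qed.

Lemma exists_annihilator2 n r q (A : 'M[F]_(n, r)) (B : 'M[F]_(n, q))
    (S : {set 'I_r}) (T : {set 'I_q}) : (#|S| + #|T| < n)%N ->
  exists x : 'rV[F]_n,
    [/\ x != 0, S \subset zeros (x *m A) & T \subset zeros (x *m B)].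
Proof.
pose f := @enum_val _ (mem S); pose g := @enum_val _ (mem T).
case/(@exists_annihilator _ _ (row_mx (colsub f A) (colsub g B))) => x x0.
rewrite mul_mx_row -[0](@row_mx0 _ 1 #|S| #|T|) => /eq_row_mx[xA xB].
exists x; split=> //; apply/subsetP => j jS; rewrite inE.
- move/rowP/(_ (enum_rank_in jS j)): xA.
  by rewrite mulmx_colsub [LHS]mxE [RHS]mxE /f enum_rankK_in // => /eqP.
- move/rowP/(_ (enum_rank_in jS j)): xB.
  by rewrite mulmx_colsub [LHS]mxE [RHS]mxE /g enum_rankK_in // => /eqP.
Qed.

Lemma exists_annihilator1 n r (A : 'M[F]_(n, r)) (S : {set 'I_r}) :
  (#|S| < n)%N -> exists2 x : 'rV[F]_n, x != 0 & S \subset zeros (x *m A).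
Proof.
move=> ltS; have [|x [x0 Sx _]] := @exists_annihilator2 _ _ _ A A S set0.
  by rewrite cards0 addn0.
by exists x.
Qed.

Lemma exists_subset_card (T : finType) (S : {set T}) k : (k <= #|S|)%N ->
  exists2 U : {set T}, U \subset S & #|U| = k.
Proof.
move=> kS; exists [set x in take k (enum S)].
  by apply/subsetP => x; rewrite inE => /mem_take; rewrite mem_enum.
rewrite cardsE; have/card_uniqP -> := take_uniq k (enum_uniq (mem S)).
by rewrite size_takel // -cardE.
Qed.

(** Extending [S] to [n - 1] columns other than [l] leaves a nonzero [x] that
    kills them all, and then general position forbids killing [l] as well. *)
Lemma separate_column n r (A : 'M[F]_(n, r)) (S : {set 'I_r}) (l : 'I_r) :
  general_position A -> (n <= r)%N -> (#|S| < n)%N -> l \notin S ->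
  exists x : 'rV[F]_n, [/\ x != 0, S \subset zeros (x *m A) &
    (x *m A) 0 l != 0].
Proof.
move=> gpA ler ltS lS.
have cS : #|~: (l |: S)| = (r - #|S|.+1)%N.
  by rewrite cardsCs setCK card_ord cardsU1 lS.
have [|U sU cU] := @exists_subset_card _ (~: (l |: S)) (n.-1 - #|S|).
  by rewrite cS; lia.
have SU : S \subset S :|: U := subsetUl _ _.
have cSU : #|S :|: U| = n.-1.
  rewrite cardsU (_ : S :&: U = set0) ?cards0 ?cU; first by lia.
  apply/setP => j; rewrite !inE; apply/negP => /andP[jS /(subsetP sU)].
  by rewrite !inE jS orbT.
have lSU : l \notin S :|: U.
  by rewrite inE (negPf lS); apply: contraT => /negPn/(subsetP sU); rewrite !inE eqxx.
have [|x x0 xSU] := @exists_annihilator1 _ _ A (S :|: U); first by lia.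
exists x; split=> //; first exact: subset_trans xSU.
apply/negP => xl; have := gpA x x0; rewrite ltnNge => /negP; apply.
have : (l |: (S :|: U)) \subset zeros (x *m A) by rewrite subUset sub1set inE xl.
by move/subset_leq_card; rewrite cardsU1 lSU cSU add1n (ltn_predK ltS).
Qed.

End GeneralPosition.

(** * Kruskal's permutation lemma *)

(** With [u = s + 1 - v], the excluded inequality is
    [(r - s - 1) * (u - 1) <= 0], but [r - s] and [u] are at least 2. *)
Lemma flats_overfull r n s v : (s.+1 < n)%N -> (n <= r)%N -> (v < s)%N ->
  ~ ((r - s) * (s.+1 - v) <= r - v)%N.
Proof.
move=> ltsn ler ltvs.
have -> : (r - s = (r - s - 2).+2)%N by lia.
have -> : (s.+1 - v = (s - v - 1).+2)%N by lia.
have -> : (r - v = (r - s - 2) + (s - v - 1) + 3)%N by lia.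
nia.
Qed.

Section Flats.
Variables (F : fieldType) (n r : nat) (A B : 'M[F]_(n, r)).
Hypotheses (gpA : general_position A) (gpB : general_position B).
Hypothesis ler : (n <= r)%N.
Implicit Types S T : {set 'I_r}.

(** The columns of [A] lying in the span of the columns of [B] indexed by [S];
    the span is described by its annihilator, so that no bases are needed. *)
Definition flat (S : {set 'I_r}) : {set 'I_r} :=
  [set l | `[< forall x : 'rV_n, S \subset zeros (x *m B) ->
                 (x *m A) 0 l = 0 >]].

Lemma flatP S l : reflect (forall x : 'rV_n, S \subset zeros (x *m B) ->
  (x *m A) 0 l = 0) (l \in flat S).
Proof. by rewrite inE; apply: asboolP. Qed.

Lemma flatS S T : S \subset T -> flat S \subset flat T.
Proof.
by move=> ST; apply/subsetP => l /flatP Sl; apply/flatP => x xT; apply: Sl;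
  exact: subset_trans xT.
Qed.

(** Otherwise some nonzero [x] kills [S], hence [#|S| + 1] columns of [A], and
    there is enough freedom left to kill [n - 1 - #|S|] further columns of [A]. *)
Lemma leq_card_flat S : (#|S| < n)%N -> (#|flat S| <= #|S|)%N.
Proof.
move=> ltS; rewrite leqNgt; apply/negP => /exists_subset_card[L sL cL].
have [|U sU cU] := @exists_subset_card _ (~: L) (n - #|S|.+1).
  by rewrite (cardsCs (~: L)) setCK card_ord cL leq_sub2r.
have [|x [x0 xS xU]] := @exists_annihilator2 _ _ _ _ B A S U; first by lia.
have xL : L \subset zeros (x *m A).
  by apply/subsetP => l /(subsetP sL)/flatP/(_ x xS) xl; rewrite inE xl.
have : L :|: U \subset zeros (x *m A) by rewrite subUset xL.
move/subset_leq_card; rewrite cardsU (_ : L :&: U = set0); last first.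
  by apply/setP => j; rewrite !inE; apply/negP => /andP[jL /(subsetP sU)]; rewrite inE jL.
by rewrite cards0 cL cU; have := gpA x0; lia.
Qed.

(** Some [y] kills [S] and [k], hence column [l] of [A], but not [j].  Subtracting
    a multiple of [y] makes an annihilator of [S] kill [j] as well, without
    changing its value on column [l]. *)
Lemma flat_meet S j k l : (#|S|.+1 < n)%N -> j \notin S -> k != j ->
  l \in flat (j |: S) -> l \in flat (k |: S) -> l \in flat S.
Proof.
move=> ltS jS kj /flatP lj /flatP lk; apply/flatP => x xS.
have [||y [_ /[!(subUset, sub1set)] /andP[yk yS] yj]] := @separate_column _ _ _ B (k |: S) j gpB ler.
- by rewrite cardsU1; apply: leq_ltn_trans ltS; rewrite -add1n leq_add2r leq_b1.
- by rewrite !inE eq_sym (negPf kj).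
have yl : (y *m A) 0 l = 0 by apply: lk; rewrite subUset sub1set yk.
pose c := (x *m B) 0 j / (y *m B) 0 j.
have cE (M : 'M[F]_(n, r)) i :
    ((x - c *: y) *m M) 0 i = (x *m M) 0 i - c * (y *m M) 0 i.
  rewrite mulmxBl -scalemxAl [LHS]mxE; congr (_ + _).
  by rewrite [LHS]mxE [in LHS]mxE.
suff: ((x - c *: y) *m A) 0 l = 0 by rewrite cE yl mulr0 subr0.
apply: lj; apply/subsetP => i; rewrite !inE cE.
case/predU1P => [->|iS]; first by rewrite divfK // subrr.
have /[!inE]/eqP -> := subsetP xS i iS.
have /[!inE]/eqP -> := subsetP yS i iS.
by rewrite mulr0 subr0.
Qed.

(** The [r - #|S|] flats spanned by [S] and one more column meet in the flat of
    [S]; if that contained fewer than [#|S|] columns of [A], the remaining ones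
    would be too few to fill them. *)
Lemma card_flat_step S : (#|S|.+1 < n)%N ->
  (forall T : {set 'I_r}, #|T| = #|S|.+1 -> #|flat T| = #|S|.+1) ->
  #|flat S| = #|S|.
Proof.
move=> ltS flatT; apply/eqP; rewrite eqn_leq leq_card_flat ?(ltnW ltS) //=.
have le_sum : (\sum_(j in ~: S) #|flat (j |: S) :\: flat S| <= #|~: flat S|)%N.
  under eq_bigr do rewrite -sum1_card.
  rewrite (exchange_big_dep (mem (~: flat S))) /=; last first.
    by move=> j l _; rewrite !inE => /andP[].
  rewrite -[leqRHS]sum1_card; apply: leq_sum => l _.
  (* A column of [A] off the flat of [S] lies in at most one larger flat. *)
  rewrite sum1_card; apply/card_le1_eqP => j k.
  move=> /andP[+ +] /andP[_ +]; rewrite in_setC !in_setD.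
  move=> jS /andP[lS lj] /andP[_ lk]; apply/eqP; apply: contraNT lS => kj.
  exact: flat_meet lj lk.
have eq_sum : (\sum_(j in ~: S) #|flat (j |: S) :\: flat S| =
               (r - #|S|) * (#|S|.+1 - #|flat S|))%N.
  rewrite -[(r - _)%N](_ : #|~: S| = _); last by rewrite cardsCs setCK card_ord.
  rewrite -sum_nat_const; apply: eq_bigr => j; rewrite inE => jS.
  by rewrite cardsDS ?flatS ?subsetUr // flatT // cardsU1 jS.
rewrite leqNgt; apply/negP => lt_flat.
move: le_sum; rewrite eq_sum (cardsCs (~: flat S)) setCK card_ord.
move=> le_sum; exact: (@flats_overfull r n #|S| #|flat S|).
Qed.

Hypothesis zerosBA : forall x : 'rV_n, x != 0 ->
  (n.-1 <= #|zeros (x *m B)|)%N -> (n.-1 <= #|zeros (x *m A)|)%N.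

(** By general position of [B] the annihilator of [n - 1] of its columns is a
    line, so all columns of [A] killed by one nonzero element of it lie in the
    flat. *)
Lemma card_flat_hyperplane S : (0 < n)%N -> #|S| = n.-1 -> #|flat S| = n.-1.
Proof.
move=> n0 cS; apply/eqP; rewrite eqn_leq -{1}cS leq_card_flat ?cS ?prednK //=.
have [|x x0 xS] := @exists_annihilator1 _ _ _ B S; first by rewrite cS prednK.
apply: leq_trans (zerosBA x0 _) _; first by rewrite -cS subset_leq_card.
apply: subset_leq_card; apply/subsetP => l /[!inE]/eqP xl.
apply/asboolP => y yS.
have [j jS] : exists j, j \notin S.
  apply/existsP; rewrite -negb_forall; apply/negP => /forallP allS.
  have : [set: 'I_r] \subset S by apply/subsetP => j _; apply: allS.
  by move/subset_leq_card; rewrite cardsT card_ord cS; lia.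
have kills_all (z : 'rV_n) : S \subset zeros (z *m B) -> (z *m B) 0 j = 0 -> z = 0.
  move=> zS zj; apply/eqP; apply: contraT => /gpB.
  have /subset_leq_card : j |: S \subset zeros (z *m B).
    by rewrite subUset sub1set inE zj eqxx.
  by rewrite cardsU1 jS cS add1n (prednK n0) ltnNge => ->.
have xj : (x *m B) 0 j != 0.
  by apply: contra_neq x0 => xj; exact: kills_all.
have : y - ((y *m B) 0 j / (x *m B) 0 j) *: x = 0.
  apply: kills_all.
    apply/subsetP => i iS; rewrite inE mulmxBl -scalemxAl [_ 0 i]mxE.
    have /[!inE]/eqP -> := subsetP yS i iS.
    rewrite [X in _ + X]mxE [X in _ - X]mxE.
    by have /[!inE]/eqP -> := subsetP xS i iS; rewrite mulr0 subr0.
  rewrite mulmxBl -scalemxAl [LHS]mxE [X in _ + X]mxE [X in _ - X]mxE.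
  by rewrite divfK // subrr.
by move/eqP; rewrite subr_eq0 => /eqP ->; rewrite -scalemxAl mxE xl mulr0.
Qed.

Lemma card_flat S : (#|S| < n)%N -> #|flat S| = #|S|.
Proof.
move=> ltS; have [k] := ubnP (n.-1 - #|S|); elim: k S ltS => // k IHk S ltS ltk.
have [eqS|neS] := eqVneq #|S| n.-1.
  by rewrite eqS card_flat_hyperplane //; lia.
by apply: card_flat_step => [|T cT]; [lia | rewrite -cT; apply: IHk; lia].
Qed.

Lemma general_position_col_neq0 (M : 'M[F]_(n, r)) l :
  (1 < n)%N -> general_position M -> col l M != 0.
Proof.
move=> n1 gpM; have [||x [_ _ xl]] := @separate_column _ _ _ M set0 l gpM ler.
- by rewrite cards0; lia.
- by rewrite inE.
apply: contra_neq xl => Ml.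
transitivity ((x *m col l M) 0 0); last by rewrite Ml mulmx0 mxE.
by rewrite !mxE; apply: eq_bigr => i _; rewrite mxE.
Qed.

(** The forms [e_k - (b_k / b_i) e_i] kill column [b] of [B], hence also the
    column of [A] in its flat, which is therefore a multiple of [b]. *)
Lemma match_column j : (1 < n)%N ->
  exists l c, c != 0 /\ col j B = c *: col l A.
Proof.
move=> n1; have := @card_flat [set j]; rewrite cards1 => /(_ n1)/eqP/cards1P[l lj].
have /flatP jl : l \in flat [set j] by rewrite lj set11.
have Bj := general_position_col_neq0 j n1 gpB.
have Al := general_position_col_neq0 l n1 gpA.
have /cV0Pn[i Bij] := Bj; rewrite mxE in Bij.
have killA (k : 'I_n) : A k l = B k j / B i j * A i l.
  apply/eqP; rewrite -subr_eq0; apply/eqP.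
  have := jl (delta_mx 0 k - (B k j / B i j) *: delta_mx 0 i).
  rewrite !mulmxBl -!scalemxAl -!rowE !mxE => -> //.
  by rewrite sub1set inE !mxE divfK // subrr.
have Ail : A i l != 0.
  apply: contra_neq Al => Ail; apply/colP => k; rewrite !mxE killA Ail mulr0 //.
exists l, (B i j / A i l); split; first by rewrite mulf_neq0 ?invr_eq0.
by apply/colP => k; rewrite !mxE (killA k); field; rewrite Ail Bij.
Qed.

End Flats.

(** The columns of [B] are recovered as intersections of the hyperplanes spanned
    by [n - 1] of them.  Minimality of the weights makes every such hyperplane
    contain [n - 1] columns of [A]; intersecting, each line spanned by a column
    of [B] contains a column of [A]. *)
Theorem kruskal_permutation (F : fieldType) n r q
    (A : 'M[F]_(n, r)) (B : 'M[F]_(n, q)) :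
  (1 < n)%N -> (n <= r)%N -> (q <= r)%N -> general_position A ->
  (forall x : 'rV_n, (weight (x *m B) <= (r - n).+1)%N ->
                     (weight (x *m A) <= weight (x *m B))%N) ->
  q = r /\ exists s : 'I_q -> 'I_r, injective s /\
    forall j, exists2 c, c != 0 & col j B = c *: col (s j) A.
Proof.
move=> n1 ler leq gpA wBA.
have zA (x : 'rV_n) : x != 0 -> (#|zeros (x *m A)| < n)%N by exact: gpA.
(* A lighter [x *m B] would make [x *m A] vanish on [n] columns. *)
have wB (x : 'rV_n) : x != 0 -> (r - n < weight (x *m B))%N.
  move=> x0; rewrite ltnNge; apply/negP => wx.
  have := wBA x (leqW wx); have := zA x x0; have := card_zeros (x *m A).
  by lia.
have neq : (n <= q)%N.
  rewrite leqNgt; apply/negP => /(@exists_annihilator _ _ _ B)[x x0 xB].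
  have := wB x x0; rewrite xB (_ : weight _ = 0%N) //.
  by apply/eqP; rewrite cards_eq0; apply/eqP/setP => j; rewrite !inE mxE eqxx.
have qr : q = r.
  have [|S _ cS] := @exists_subset_card 'I_q setT n.-1.
    by rewrite cardsT card_ord; lia.
  have [|x x0 /subset_leq_card] := @exists_annihilator1 _ _ _ B S; first by lia.
  by have := wB x x0; have := card_zeros (x *m B); lia.
split=> //; subst q.
have gpB : general_position B.
  by move=> x x0; have := wB x x0; have := card_zeros (x *m B); lia.
have zBA (x : 'rV_n) : x != 0 ->
    (n.-1 <= #|zeros (x *m B)|)%N -> (n.-1 <= #|zeros (x *m A)|)%N.
  move=> x0 zx; have := wBA x; have := card_zeros (x *m B).
  by have := card_zeros (x *m A); lia.
have /choice[s sP] := fun j => match_column gpA gpB ler zBA j n1.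
exists s; split=> [j k sjk|j]; last by have [c []] := sP j; exists c.
apply/eqP; apply: contraT => kj.
have [||x [_ xk xj]] := @separate_column _ _ _ B [set k] j gpB ler.
- by rewrite cards1.
- by rewrite inE.
have [c [c0 Bj]] := sP j; have [d [d0 Bk]] := sP k.
have dotE (M : 'M[F]_(n, r)) l : (x *m M) 0 l = (x *m col l M) 0 0.
  by rewrite !mxE; apply: eq_bigr => i _; rewrite mxE.
move: xk; rewrite sub1set inE dotE Bk -scalemxAr mxE mulf_eq0 (negPf d0) -sjk /=.
by move=> /eqP xs; rewrite dotE Bj -scalemxAr mxE xs mulr0 eqxx in xj.
Qed.

(** * Uniqueness from a rank condition *)

Lemma mul_diag_trE (F : fieldType) n K r (A : 'M[F]_(n, r)) (u : 'rV_r)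
    (C : 'M[F]_(K, r)) i k :
  (A *m diag_mx u *m C^T) i k = \sum_l A i l * u 0 l * C k l.
Proof. by rewrite mxE; apply: eq_bigr => l _; rewrite mul_mx_diag !mxE. Qed.

Section RankBounds.
Variables (F : fieldType) (n K r : nat).
Implicit Types (A : 'M[F]_(n, r)) (C : 'M[F]_(K, r)) (u : 'rV[F]_r).

(** The matrix factors through the coordinates in the support of [u]. *)
Lemma rank_mul_diag_tr A u C : (\rank (A *m diag_mx u *m C^T) <= weight u)%N.
Proof.
pose g := @enum_val _ (mem (~: zeros u)).
have -> : A *m diag_mx u *m C^T =
          colsub g (A *m diag_mx u) *m rowsub g C^T.
  apply/matrixP => i k; rewrite mul_diag_trE mxE.
  transitivity (\sum_(l in ~: zeros u) A i l * u 0 l * C k l).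
    rewrite [RHS]big_mkcond; apply: eq_bigr => l _; rewrite !inE.
    by case: eqP => //= ->; rewrite mulr0 mul0r.
  by rewrite big_enum_val; apply: eq_bigr => l _; rewrite mul_mx_diag !mxE.
exact: mulmx_max_rank.
Qed.

(** Choose [k] indices in the support.  Linear forms killing all columns of [A] in
    the support but one, and all chosen columns of [C] but one, diagonalise the
    matrix on these indices. *)
Lemma leq_rank_mul_diag_tr A u C k :
  general_position A -> general_position C -> (n <= r)%N -> (K <= r)%N ->
  (weight u <= n)%N -> (k <= weight u)%N -> (k <= K)%N ->
  (k <= \rank (A *m diag_mx u *m C^T))%N.
Proof.
move=> gpA gpC ler leKr wn kw kK.
have [S sS cS] := exists_subset_card kw; subst k.
pose e := @enum_val _ (mem S).
have uN0 l : l \in ~: zeros u -> u 0 l != 0 by rewrite !inE.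
have /choice[y yP] : forall s, exists y : 'rV_n,
    (~: zeros u) :\ e s \subset zeros (y *m A) /\ (y *m A) 0 (e s) != 0.
  move=> s; have [||y [_ yu ys]] := separate_column (S := (~: zeros u) :\ e s)
    (l := e s) gpA ler.
  - apply: leq_trans wn; rewrite /weight [leqRHS](cardsD1 (e s)).
    by rewrite (subsetP sS _ (enum_valP s)).
  - by rewrite !inE eqxx.
  by exists y.
have /choice[z zP] : forall s, exists z : 'rV_K,
    S :\ e s \subset zeros (z *m C) /\ (z *m C) 0 (e s) != 0.
  move=> s; have [||z [_ zu zs]] := separate_column (S := S :\ e s)
    (l := e s) gpC leKr.
  - by apply: leq_trans kK; rewrite [leqRHS](cardsD1 (e s)) enum_valP.
  - by rewrite !inE eqxx.
  by exists z.
pose Y := \matrix_s y s; pose Z := \matrix_s z s.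
pose d := \row_s ((y s *m A) 0 (e s) * u 0 (e s) * (z s *m C) 0 (e s)).
have rowE m (M : 'M[F]_(m, r)) (v : 'I_#|S| -> 'rV_m) s l :
    (\matrix_s v s *m M) s l = (v s *m M) 0 l.
  by rewrite !mxE; apply: eq_bigr => i _; rewrite mxE.
have YZ : Y *m (A *m diag_mx u *m C^T) *m Z^T = diag_mx d.
  have -> : Y *m (A *m diag_mx u *m C^T) *m Z^T =
            (Y *m A) *m diag_mx u *m (Z *m C)^T by rewrite trmx_mul !mulmxA.
  apply/matrixP => s t; rewrite mul_diag_trE (bigD1 (e s)) //= big1 => [|l ls].
    rewrite !rowE addr0 [RHS]mxE [X in _ = X *+ _]mxE; have [<-|st] := eqVneq s t; first by rewrite mulr1n.
    have /[!inE]/eqP -> : e s \in zeros (z t *m C); last by rewrite mulr0 mulr0n.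
    by apply: (subsetP (proj1 (zP t))); rewrite !inE (inj_eq enum_val_inj) st enum_valP.
  rewrite !rowE; have [ul|ul] := boolP (l \in zeros u).
    by move: ul; rewrite inE => /eqP ->; rewrite mulr0 mul0r.
  have /[!inE]/eqP -> : l \in zeros (y s *m A); last by rewrite !mul0r.
  by apply: (subsetP (proj1 (yP s))); rewrite !inE ls in ul *.
have: \rank (diag_mx d) = #|S|.
  apply: mxrank_unit; rewrite unitmxE det_diag unitfE.
  apply/prodf_neq0 => s _; rewrite mxE !mulf_neq0 ?(proj2 (yP s)) ?(proj2 (zP s)) //.
  by apply/uN0/(subsetP sS)/enum_valP.
rewrite -YZ => <-; apply: leq_trans (mxrankM_maxl _ _) _.
exact: mxrankM_maxr.
Qed.

(** For each [s] the other columns split into two sets of fewer than [n]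
    elements.  Contracting with linear forms killing one set each, but not column
    [s], leaves only the term [s]. *)
Lemma column_squares_independent A (d : 'I_r -> F) :
  general_position A -> (n <= r)%N -> (r < n.*2)%N ->
  (forall i j, \sum_l A i l * A j l * d l = 0) -> forall s, d s = 0.
Proof.
move=> gpA ler ltr dA s.
have [|S sS cS] := @exists_subset_card _ (~: [set s]) (r - n).
  by rewrite cardsC1 card_ord; lia.
have sNS : s \notin S by apply/negP => /(subsetP sS); rewrite !inE eqxx.
have [|x [_ xS xs]] := separate_column (S := S) gpA ler _ sNS.
  by rewrite cS; lia.
have [||y [_ yS ys]] := separate_column (S := ~: (s |: S)) (l := s) gpA ler.
- by rewrite cardsCs setCK card_ord cardsU1 sNS cS; lia.
- by rewrite !inE eqxx.
have : \sum_l (x *m A) 0 l * (y *m A) 0 l * d l = 0.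
  transitivity (\sum_i \sum_j x 0 i * y 0 j * (\sum_l A i l * A j l * d l)).
    under [RHS]eq_bigr do under eq_bigr do rewrite mulr_sumr.
    under [RHS]eq_bigr do rewrite exchange_big.
    rewrite [RHS]exchange_big; apply: eq_bigr => l _.
    rewrite !mxE mulr_suml mulr_suml; apply: eq_bigr => i _.
    by rewrite mulr_sumr mulr_suml; apply: eq_bigr => j _; ring.
  by apply: big1 => i _; apply: big1 => j _; rewrite dA mulr0.
rewrite (bigD1 s) //= big1 => [|l ls].
  by rewrite addr0 => /eqP; rewrite !mulf_eq0 (negPf xs) (negPf ys) => /eqP.
have [lS|lS] := boolP (l \in S).
  by have /[!inE]/eqP -> := subsetP xS l lS; rewrite !mul0r.
have /[!inE]/eqP -> : l \in zeros (y *m A); last by rewrite mulr0 mul0r.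
by apply: (subsetP yS); rewrite !inE negb_or ls.
Qed.

End RankBounds.

Section Uniqueness.
Variables (F : fieldType) (n K r : nat) (A : 'M[F]_(n, r)) (C : 'M[F]_(K, r)).
Hypotheses (n1 : (1 < n)%N) (ler : (n <= r)%N).
Hypotheses (leKn : (K <= n)%N) (lemK : ((r - n).+2 <= K)%N).
Hypotheses (gpA : general_position A) (gpC : general_position C).
Hypothesis rankAC : forall x : 'rV_n, (n <= weight (x *m A))%N ->
  ((r - n).+2 <= \rank (A *m diag_mx (x *m A) *m C^T))%N.

Definition term m q (M : 'M[F]_(m, q)) (N : 'M[F]_(K, q)) l : tensor F m m K :=
  outer3 (col l M) (col l M) (col l N).

Lemma polyadicE q (M : 'M[F]_(n, q)) (N : 'M[F]_(K, q)) i j k :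
  polyadic M M N (i, j, k) = \sum_l M i l * M j l * N k l.
Proof. by rewrite sum_ffunE; apply: eq_bigr => l _; rewrite ffunE !mxE. Qed.

Lemma contract_polyadic q (M : 'M[F]_(n, q)) (N : 'M[F]_(K, q)) (x : 'rV_n) i k :
  (M *m diag_mx (x *m M) *m N^T) i k =
  \sum_j x 0 j * polyadic M M N (i, j, k).
Proof.
rewrite mul_diag_trE; under [RHS]eq_bigr do rewrite polyadicE mulr_sumr.
rewrite exchange_big; apply: eq_bigr => l _.
by rewrite mxE mulr_sumr mulr_suml; apply: eq_bigr => j _; ring.
Qed.

Lemma minn_weight_rank (x : 'rV_n) :
  (minn (weight (x *m A)) (r - n).+2 <=
   \rank (A *m diag_mx (x *m A) *m C^T))%N.
Proof.
have [wn|nw] := leqP (weight (x *m A)) n.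
  by apply: leq_rank_mul_diag_tr => //; lia.
by apply: leq_trans (rankAC (ltnW nw)); exact: geq_minr.
Qed.

(** Contracting along [x] turns both decompositions into one matrix, whose rank
    compares the weights of the two coefficient vectors; Kruskal's lemma then
    matches the first factors, and independence of the squares of the columns
    of [A] the second ones. *)
Lemma polyadic_terms_match q (M : 'M[F]_(n, q)) (N : 'M[F]_(K, q)) :
  (q <= r)%N -> polyadic M M N = polyadic A A C ->
  q = r /\ exists2 s : 'I_q -> 'I_r, injective s &
    forall l, term M N l = term A C (s l).
Proof.
move=> leqr eqT.
have [x wx|qr [s [inj_s colM]]] := @kruskal_permutation _ n r q A M n1 ler leqr gpA.
  have eqM : A *m diag_mx (x *m A) *m C^T = M *m diag_mx (x *m M) *m N^T.
    by apply/matrixP => i k; rewrite !contract_polyadic eqT.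
  have := minn_weight_rank x; rewrite eqM => /leq_trans/(_ (rank_mul_diag_tr _ _ _)).
  by rewrite geq_min => /orP[//|]; lia.
split=> //; exists s => // l; subst q.
have [c cP] : exists c : 'I_r -> F, forall l, col l M = c l *: col (s l) A.
  have /choice[c cP] : forall l, exists c, col l M = c *: col (s l) A.
    by move=> j; have [c _ ->] := colM j; exists c.
  by exists c.
have ME i j : M i j = c j * A i (s j).
  by have /colP/(_ i) := cP j; rewrite !mxE.
pose t := invF inj_s.
have eqN k : N k l * c l ^+ 2 = C k (s l).
  pose d j := N k (t j) * c (t j) ^+ 2 - C k j.
  suff /(_ (s l)) : forall j, d j = 0.
    by rewrite /d /t invF_f => /eqP; rewrite subr_eq0 => /eqP.
  apply: (column_squares_independent gpA ler); first by lia.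
  move=> i j; under eq_bigr do rewrite mulrBr.
  rewrite sumrB -polyadicE -eqT polyadicE; apply/eqP; rewrite subr_eq0; apply/eqP.
  rewrite (reindex_inj inj_s); apply: eq_bigr => b _.
  by rewrite /t invF_f !ME; ring.
by apply/ffunP => -[[i j] k]; rewrite !ffunE !mxE /= !ME -eqN; ring.
Qed.

Lemma SFS_decomposition_polyadic (T : tensor F n n K) (s : seq (tensor F n n K)) :
  SFS_decomposition T s ->
  exists M, exists2 N, polyadic M M N = T &
    forall l : 'I_(size s), term M N l = tnth (in_tuple s) l.
Proof.
case=> rank1 sumT.
have /choice[f fP] : forall l : 'I_(size s), exists ac : 'cV_n * 'cV_K,
    tnth (in_tuple s) l = outer3 ac.1 ac.1 ac.2.
  by move=> l; have [a [c [_ _ ->]]] := rank1 _ (mem_tnth l (in_tuple s)); exists (a, c).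
pose M := \matrix_(i, l) (f l).1 i 0; pose N := \matrix_(k, l) (f l).2 k 0.
have termE l : term M N l = tnth (in_tuple s) l.
  by rewrite fP; congr outer3; apply/colP => i; rewrite !mxE.
exists M, N => //; rewrite -sumT (big_tnth _ _ s).
by apply: eq_bigr => l _; exact: termE.
Qed.

Lemma term_rank1 l : SFS_rank1 (term A C l).
Proof.
exists (col l A), (col l C); split=> //; apply: general_position_col_neq0 => //; lia.
Qed.

Theorem SFS_CPD_unique_polyadic : SFS_CPD_unique (polyadic A A C).
Proof.
pose s := [seq term A C l | l <- enum 'I_r].
have size_s : size s = r by rewrite size_map size_enum_ord.
have decs : SFS_decomposition (polyadic A A C) s.
  split; first by move=> X /mapP[l _ ->]; exact: term_rank1.
  by rewrite big_map big_enum.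
have min_s s' : SFS_decomposition (polyadic A A C) s' -> (r <= size s')%N.
  move=> /SFS_decomposition_polyadic[M [N eqT _]].
  by rewrite leqNgt; apply/negP => lts; have [] := polyadic_terms_match (ltnW lts) eqT; lia.
exists s; first by split=> //; rewrite size_s; split=> //; exists s.
move=> s' [dec' [_ /(_ s decs)]]; rewrite size_s => les'.
have [M [N eqT termE]] := SFS_decomposition_polyadic dec'.
have [sr [f inj_f fP]] := polyadic_terms_match les' eqT.
have -> : s' = [seq term A C l | l <- [seq f l | l <- enum 'I_(size s')]].
  rewrite -map_comp -[LHS](map_tnth_enum (in_tuple s')).
  by apply: eq_map => l; rewrite /= -fP termE.
apply: perm_map; rewrite perm_sym; apply: uniq_perm.
- by rewrite map_inj_uniq // enum_uniq.
- exact: enum_uniq.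
move=> l; rewrite mem_enum inE; move: f inj_f {fP}; rewrite sr => f inj_f.
apply/mapP; exists (invF inj_f l); first by rewrite mem_enum.
by rewrite f_invF.
Qed.
End Uniqueness.

(** * Polynomial functions *)

Section PolynomialFunctions.
Variable F : fieldType.
Implicit Types V W : finType.

(** Polynomials are handled as functions, so that evaluating and substituting
    need no notation; nonzero coefficients then have to be turned into nonzero
    values, see [polynomial_neq0]. *)
Definition monomial V d (a : {ffun V -> 'I_d.+1}) (v : V -> F) : F :=
  \prod_i v i ^+ a i.

(** The degree is bounded in each variable separately, which makes the number of
    monomials a power. *)
Definition degree_le V d (f : (V -> F) -> F) :=
  exists c : {ffun V -> 'I_d.+1} -> F, forall v, f v = \sum_a c a * monomial a v.

Definition polynomial V (f : (V -> F) -> F) := exists d, degree_le d f.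

Lemma degree_le_ext V d (f g : (V -> F) -> F) :
  f =1 g -> degree_le d g -> degree_le d f.
Proof. by move=> fg [c gc]; exists c => v; rewrite fg. Qed.

Lemma degree_le_monomial V d (e : V -> nat) : (forall i, (e i <= d)%N) ->
  degree_le d (fun v => \prod_i v i ^+ e i).
Proof.
move=> led; pose b := [ffun i => inord (e i)] : {ffun V -> 'I_d.+1}.
exists (fun a => (a == b)%:R) => v; rewrite (bigD1 b) //= eqxx mul1r.
rewrite [X in _ + X]big1 ?addr0 => [|a /negPf ab]; last by rewrite ab mul0r.
by apply: eq_bigr => i _; rewrite ffunE inordK ?ltnS.
Qed.

Lemma degree_le_sum V d (I : Type) (s : seq I) (P : pred I)
    (f : I -> (V -> F) -> F) :
  (forall i, P i -> degree_le d (f i)) ->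
  degree_le d (fun v => \sum_(i <- s | P i) f i v).
Proof.
move=> fd; elim: s => [|i s [c sc]].
  exists (fun=> 0) => v; rewrite big_nil big1 // => a _; exact: mul0r.
case Pi: (P i); last by exists c => v; rewrite big_cons Pi sc.
have [b fb] := fd i Pi; exists (fun a => b a + c a) => v.
rewrite big_cons Pi sc fb -big_split; apply: eq_bigr => a _.
by rewrite mulrDl.
Qed.

Lemma degree_leZ V d k (f : (V -> F) -> F) :
  degree_le d f -> degree_le d (fun v => k * f v).
Proof.
move=> [c fc]; exists (fun a => k * c a) => v; rewrite fc mulr_sumr.
by apply: eq_bigr => a _; rewrite mulrA.
Qed.

Lemma degree_le_widen V d e (f : (V -> F) -> F) : (d <= e)%N ->
  degree_le d f -> degree_le e f.
Proof.
move=> de [c /degree_le_ext]; apply; apply: degree_le_sum => a _.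
apply: degree_leZ; apply: degree_le_monomial => i.
exact: leq_trans (leq_ord _) de.
Qed.

Lemma degree_leM V d e (f g : (V -> F) -> F) :
  degree_le d f -> degree_le e g -> degree_le (d + e) (fun v => f v * g v).
Proof.
move=> [b fb] [c gc].
apply: (degree_le_ext (g := fun v => \sum_x \sum_y b x * c y *
    \prod_i v i ^+ (x i + y i))).
  move=> v; rewrite fb gc big_distrlr; apply: eq_bigr => x _.
  apply: eq_bigr => y _; rewrite /= mulrACA; congr (_ * _).
  by rewrite -big_split; apply: eq_bigr => i _; rewrite exprD.
do 2![apply: degree_le_sum => ? _]; apply: degree_leZ; apply: degree_le_monomial => i.
by rewrite leq_add // leq_ord.
Qed.

Lemma degree_le_const V d k : degree_le d (fun _ : V -> F => k).
Proof.
apply: (degree_le_ext (g := fun v => k * \prod_i v i ^+ 0)).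
  by move=> v; rewrite big1 ?mulr1.
by apply: degree_leZ; exact: degree_le_monomial.
Qed.

Lemma degree_leX V d k (f : (V -> F) -> F) : degree_le d f ->
  degree_le (k * d) (fun v => f v ^+ k).
Proof.
move=> fd; elim: k => [|k IHk]; first exact: degree_le_const.
by rewrite mulSn; apply: degree_le_ext (degree_leM fd IHk) => v; rewrite exprS.
Qed.

Lemma degree_le_prod V d (I : Type) (s : seq I) (f : I -> (V -> F) -> F) :
  (forall i, degree_le d (f i)) ->
  degree_le (size s * d) (fun v => \prod_(i <- s) f i v).
Proof.
move=> fd; elim: s => [|i s IHs].
  by apply: degree_le_ext (degree_le_const V _ 1) => v; rewrite big_nil.
rewrite /= mulSn.
by apply: degree_le_ext (degree_leM (fd i) IHs) => v; rewrite big_cons.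
Qed.

Lemma polynomial_ext V (f g : (V -> F) -> F) :
  f =1 g -> polynomial g -> polynomial f.
Proof. by move=> fg [d gd]; exists d; exact: degree_le_ext gd. Qed.

Lemma polynomial_const V k : polynomial (fun _ : V -> F => k).
Proof. by exists 0; exact: degree_le_const. Qed.

Lemma polynomial_var V i : polynomial (fun v : V -> F => v i).
Proof.
exists 1; apply: (degree_le_ext (g := fun v => \prod_j v j ^+ (j == i))).
  move=> v; rewrite (bigD1 i) //= eqxx expr1 big1 ?mulr1 // => j /negPf ji.
  by rewrite ji expr0.
by apply: degree_le_monomial => j; exact: leq_b1.
Qed.

Lemma polynomialM V (f g : (V -> F) -> F) :
  polynomial f -> polynomial g -> polynomial (fun v => f v * g v).
Proof. by move=> [d fd] [e ge]; exists (d + e)%N; exact: degree_leM. Qed.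

Lemma polynomialD V (f g : (V -> F) -> F) :
  polynomial f -> polynomial g -> polynomial (fun v => f v + g v).
Proof.
move=> [d fd] [e ge]; exists (maxn d e).
apply: (degree_le_ext (g := fun v => \sum_(b : bool) (if b then f v else g v))).
  by move=> v; rewrite big_bool.
apply: degree_le_sum => -[] _ /=.
- exact: degree_le_widen (leq_maxl _ _) fd.
- exact: degree_le_widen (leq_maxr _ _) ge.
Qed.

Lemma polynomial_sum V (I : Type) (s : seq I) (P : pred I)
    (f : I -> (V -> F) -> F) :
  (forall i, polynomial (f i)) -> polynomial (fun v => \sum_(i <- s | P i) f i v).
Proof.
move=> pf; elim: s => [|i s IHs].
  by apply: polynomial_ext (polynomial_const V 0) => v; rewrite big_nil.
case Pi: (P i).
  by apply: polynomial_ext (polynomialD (pf i) IHs) => v; rewrite big_cons Pi.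
by apply: polynomial_ext IHs => v; rewrite big_cons Pi.
Qed.

Lemma polynomial_prod V (I : Type) (s : seq I) (P : pred I)
    (f : I -> (V -> F) -> F) :
  (forall i, polynomial (f i)) -> polynomial (fun v => \prod_(i <- s | P i) f i v).
Proof.
move=> pf; elim: s => [|i s IHs].
  by apply: polynomial_ext (polynomial_const V 1) => v; rewrite big_nil.
case Pi: (P i).
  by apply: polynomial_ext (polynomialM (pf i) IHs) => v; rewrite big_cons Pi.
by apply: polynomial_ext IHs => v; rewrite big_cons Pi.
Qed.

Lemma polynomialX V k (f : (V -> F) -> F) :
  polynomial f -> polynomial (fun v => f v ^+ k).
Proof. by move=> [d fd]; exists (k * d)%N; exact: degree_leX. Qed.

Lemma polynomial_comp V W (f : (V -> F) -> F) (g : V -> (W -> F) -> F) :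
  polynomial f -> (forall i, polynomial (g i)) ->
  polynomial (fun w => f (g ^~ w)).
Proof.
move=> [d [c fc]] pg; apply: polynomial_ext (fun w => fc (g^~ w)) _.
apply: polynomial_sum => a; apply: polynomialM; first exact: polynomial_const.
by apply: polynomial_prod => i; exact: polynomialX.
Qed.

(** The relations sought are the vectors in the kernel of a linear map: with
    [d + 1] exponents per variable there are [(d + 1) ^ #|W|] monomials in the
    [phi], which lie in a space whose dimension grows only like
    [(d + 1) ^ #|V|]. *)
Theorem algebraic_dependence V W (phi : W -> (V -> F) -> F) :
  (#|V| < #|W|)%N -> (forall w, polynomial (phi w)) ->
  exists d (c : {ffun W -> 'I_d.+1} -> F), (exists a, c a != 0) /\
    forall v, \sum_a c a * monomial a (phi ^~ v) = 0.
Proof.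
move=> ltVW /choice[e pe].
(* Monomials in the [phi] of degree at most [d] have degree at most [b * d], and
   [(b * d + 1) ^ #|V| <= (b + 1) ^ #|V| * (d + 1) ^ #|V| < (d + 1) ^ #|W|]. *)
pose b := (#|W| * \max_w e w)%N.
pose d := (b.+1 ^ #|V|)%N; pose D := (b * d)%N.
have degM (a : {ffun W -> 'I_d.+1}) : degree_le D (fun v => monomial a (phi ^~ v)).
  have -> : D = (size (enum W) * (d * \max_w e w))%N.
    by rewrite -cardE /D /b -mulnA (mulnC d).
  have degX w : degree_le (d * \max_w e w) (fun v => phi w v ^+ a w).
    apply: degree_le_widen (degree_leX (a w) (pe w)).
    by rewrite leq_mul ?leq_ord ?leq_bigmax.
  apply: degree_le_ext (degree_le_prod (enum W) degX) => v.
  by rewrite big_enum.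
have /choice[q qP] := degM.
pose nW := #|{: {ffun W -> 'I_d.+1}}|; pose nV := #|{: {ffun V -> 'I_D.+1}}|.
pose Q := \matrix_(i < nW, j < nV) q (enum_val i) (enum_val j).
have lt_nV : (nV < nW)%N.
  rewrite /nV /nW !card_ffun !card_ord.
  apply: (@leq_ltn_trans ((b.+1 * d.+1) ^ #|V|)%N).
    case: #|V| => // N; rewrite leq_exp2r // /D; nia.
  rewrite expnMn -/d; apply: (@leq_trans (d.+1 ^ #|V|.+1)%N).
    by rewrite expnS ltn_pmul2r ?expn_gt0.
  by rewrite leq_exp2l // ltnS expn_gt0.
have [u u0 uQ] := exists_annihilator Q lt_nV.
exists d, (fun a => u 0 (enum_rank a)); split.
  by have /rV0Pn[i ui] := u0; exists (enum_val i); rewrite enum_valK.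
move=> v; under eq_bigr do rewrite qP mulr_sumr.
rewrite exchange_big big1 // => a _.
under eq_bigr do rewrite mulrA; rewrite -mulr_suml.
rewrite (_ : \sum_b _ = 0) ?mul0r //.
move/rowP/(_ (enum_rank a)): uQ; rewrite !mxE => uQa; rewrite -[RHS]uQa.
rewrite [RHS](reindex enum_rank) /=; last exact/onW_bij/enum_rank_bij.
by apply: eq_bigr => b' _; rewrite mxE !enum_rankK.
Qed.

(** Evaluating on the grid [{0, ..., d} ^ V] and applying the inverse of the
    Vandermonde matrix in every coordinate extracts any single coefficient. *)
Lemma polynomial_neq0 V d (c : {ffun V -> 'I_d.+1} -> F) a :
  (forall k, k.+1%:R != 0 :> F) -> c a != 0 ->
  exists v, \sum_b c b * monomial b v != 0.
Proof.
move=> char0 ca.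
pose p : 'rV[F]_d.+1 := \row_j (j : nat)%:R; pose M := Vandermonde d.+1 p.
have unitM : M \in unitmx.
  rewrite unitmxE det_Vandermonde unitfE.
  apply/prodf_neq0 => i _; apply/prodf_neq0 => j ltij; rewrite !mxE.
  rewrite -natrB ?(ltnW ltij) //.
  by rewrite -(prednK (_ : 0 < j - i)%N) ?subn_gt0.
apply: contrapT => /forallNP all0.
have {}all0 v : \sum_b c b * monomial b v = 0.
  by apply/eqP; apply: contraT => vN0; case: (all0 v).
suff : c a = 0 by move/eqP; rewrite (negPf ca).
pose w i j := invmx M j i.
have sumE (i k : 'I_d.+1) : \sum_t w i t * p 0 t ^+ k = (k == i)%:R.
  move/matrixP/(_ k i): (mulmxV unitM); rewrite [in RHS]mxE => <-.
  by rewrite mxE; apply: eq_bigr => t _; rewrite [M k t]mxE mulrC.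
transitivity (\sum_(t : {ffun V -> 'I_d.+1})
    (\prod_i w (a i) (t i)) * \sum_b c b * monomial b (fun i => p 0 (t i))).
  under eq_bigr do rewrite mulr_sumr.
  rewrite exchange_big (bigD1 a) //= [X in _ = _ + X]big1 => [|b ba]; last first.
    under eq_bigr do rewrite mulrCA -big_split /=.
    rewrite -mulr_sumr -(bigA_distr_bigA (fun i t => w (a i) t * p 0 t ^+ b i)).
    have [i bai] : exists i, b i != a i.
      apply: contrapT => /forallNP eqba; case/eqP: ba; apply/ffunP => i.
      by apply/eqP; apply: contraT => /eqba.
    by rewrite (bigD1 i) //= sumE (negPf bai) mul0r mulr0.
  under eq_bigr do rewrite mulrCA -big_split /=.
  rewrite -mulr_sumr -(bigA_distr_bigA (fun i t => w (a i) t * p 0 t ^+ a i)).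
  by rewrite big1 ?mulr1 ?addr0 // => i _; rewrite sumE eqxx.
by apply: big1 => t _; rewrite all0 mulr0.
Qed.

End PolynomialFunctions.

(** * Matrices with polynomial entries *)

Section PolynomialMatrices.
Variables (F : fieldType) (V : finType).

Definition polynomial_mx m k (M : (V -> F) -> 'M[F]_(m, k)) :=
  forall i j, polynomial (fun v => M v i j).

Lemma polynomial_mx_ext m k (M N : (V -> F) -> 'M[F]_(m, k)) :
  M =1 N -> polynomial_mx N -> polynomial_mx M.
Proof. by move=> MN pN i j; apply: polynomial_ext (pN i j) => v; rewrite MN. Qed.

Lemma polynomial_mxM m k l (M : (V -> F) -> 'M[F]_(m, k))
    (N : (V -> F) -> 'M[F]_(k, l)) :
  polynomial_mx M -> polynomial_mx N -> polynomial_mx (fun v => M v *m N v).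
Proof.
move=> pM pN i j; apply: polynomial_ext (fun v => mxE _ _ _ _) _.
by apply: polynomial_sum => s; exact: polynomialM.
Qed.

Lemma polynomial_mxD m k (M N : (V -> F) -> 'M[F]_(m, k)) :
  polynomial_mx M -> polynomial_mx N -> polynomial_mx (fun v => M v + N v).
Proof.
move=> pM pN i j; apply: polynomial_ext (fun v => mxE _ _ _ _) _.
exact: polynomialD.
Qed.

Lemma polynomial_mxZ m k (f : (V -> F) -> F) (M : (V -> F) -> 'M[F]_(m, k)) :
  polynomial f -> polynomial_mx M -> polynomial_mx (fun v => f v *: M v).
Proof.
move=> pf pM i j; apply: polynomial_ext (fun v => mxE _ _ _ _) _.
exact: polynomialM.
Qed.

Lemma polynomial_mxB m k (M N : (V -> F) -> 'M[F]_(m, k)) :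
  polynomial_mx M -> polynomial_mx N -> polynomial_mx (fun v => M v - N v).
Proof.
move=> pM pN; apply: polynomial_mx_ext (fun v => congr1 _ (esym (scaleN1r _))) _.
apply: polynomial_mxD => //; apply: polynomial_mxZ => //; exact: polynomial_const.
Qed.

Lemma polynomial_mx_tr m k (M : (V -> F) -> 'M[F]_(m, k)) :
  polynomial_mx M -> polynomial_mx (fun v => (M v)^T).
Proof. by move=> pM i j; apply: polynomial_ext (pM j i) => v; rewrite mxE. Qed.

Lemma polynomial_mx_diag k (M : (V -> F) -> 'rV[F]_k) :
  polynomial_mx M -> polynomial_mx (fun v => diag_mx (M v)).
Proof.
move=> pM i j; apply: polynomial_ext (fun v => mxE _ _ _ _) _.
by case: (i == j); [exact: pM | exact: polynomial_const].
Qed.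

Lemma polynomial_mx_sub m k m' k' (f : 'I_m' -> 'I_m) (g : 'I_k' -> 'I_k)
    (M : (V -> F) -> 'M[F]_(m, k)) :
  polynomial_mx M -> polynomial_mx (fun v => mxsub f g (M v)).
Proof.
by move=> pM i j; apply: polynomial_ext (pM (f i) (g j)) => v; rewrite mxE.
Qed.

Lemma polynomial_det k (M : (V -> F) -> 'M[F]_k) :
  polynomial_mx M -> polynomial (fun v => \det (M v)).
Proof.
move=> pM; apply: polynomial_sum => s; apply: polynomialM.
  exact: polynomial_const.
by apply: polynomial_prod.
Qed.

Lemma polynomial_mx_adj k (M : (V -> F) -> 'M[F]_k) :
  polynomial_mx M -> polynomial_mx (fun v => \adj (M v)).
Proof.
move=> pM i j; apply: polynomial_ext (fun v => mxE _ _ _ _) _.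
apply: polynomialM; first exact: polynomial_const.
by apply: polynomial_det => s t; apply: polynomial_ext (pM (lift j s) (lift i t)) => v; rewrite !mxE.
Qed.

End PolynomialMatrices.

(** * The exceptional factors form a null set *)

Section ExceptionalFactors.
Variables (F : fieldType) (n K r : nat).
Hypothesis char0 : forall k, k.+1%:R != 0 :> F.
Local Notation factors := ('M[F]_(n, r) * 'M[F]_(K, r))%type.
Local Notation index := ('I_n * 'I_r + 'I_K * 'I_r)%type.

Definition entry (AC : factors) (w : index) : F :=
  match w with inl (i, l) => AC.1 i l | inr (k, l) => AC.2 k l end.

Definition of_entries (e : index -> F) : factors :=
  (\matrix_(i, l) e (inl (i, l)), \matrix_(k, l) e (inr (k, l))).

Lemma of_entriesK e : entry (of_entries e) =1 e.
Proof. by case=> -[i l]; rewrite /= mxE. Qed.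

(** The properties of sets of measure zero that the argument uses, shared by the
    real and the complex case. *)
Record null_ideal (null : set factors -> Prop) : Prop := {
  null_subset : forall S T, (S `<=` T)%classic -> null T -> null S;
  null_union : forall S T, null S -> null T -> null (S `|` T)%classic;
  null_zeros : forall P, polynomial P -> (exists AC, P (entry AC) != 0) ->
    null [set AC | P (entry AC) = 0]%classic }.

Variable null : set factors -> Prop.
Hypothesis nullP : null_ideal null.

Lemma null_set0 : null classical_sets.set0.
Proof.
apply: null_subset (null_zeros nullP (polynomial_const _ 1) _) => //.
by exists (of_entries (fun=> 0)); exact: oner_neq0.
Qed.

Lemma null_exists (I : finType) (S : I -> set factors) :
  (forall i, null (S i)) -> null [set AC | exists i, S i AC]%classic.
Proof.
move=> nullS.
suff : null [set AC | exists2 i, i \in enum I & S i AC]%classic.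
  apply: (null_subset nullP) => AC [i SiAC]; exists i => //.
  by rewrite mem_enum.
elim: (enum I) => [|i s IHs].
  by apply: (null_subset nullP) null_set0 => AC [].
apply: (null_subset nullP) (null_union nullP (nullS i) IHs) => AC [j].
by rewrite inE => /predU1P[->|js] SjAC; [left | right; exists j].
Qed.

Lemma null_if (b : bool) (S : set factors) :
  (b -> null S) -> null [set AC | b /\ S AC]%classic.
Proof.
case: b => [/(_ isT)|_]; first by apply: (null_subset nullP) => AC [].
by apply: (null_subset nullP) null_set0 => AC [].
Qed.

(** The coordinates of [psi] satisfy a nontrivial algebraic relation, whose zero
    set contains the image. *)
Lemma null_range (V : finType) (psi : (V -> F) -> factors) :
  (#|V| < n * r + K * r)%N ->
  polynomial_mx (fun v => (psi v).1) -> polynomial_mx (fun v => (psi v).2) ->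
  null (range psi).
Proof.
move=> ltV p1 p2.
have [||d [c [[a ca] rel]]] := @algebraic_dependence F V index
    (fun w v => entry (psi v) w).
- by rewrite card_sum !card_prod !card_ord.
- by case=> -[i l]; [exact: p1 | exact: p2].
have [e eN0] := polynomial_neq0 char0 ca.
pose P e' := \sum_b c b * monomial b e'.
have extP e1 e2 : e1 =1 e2 -> P e1 = P e2.
  move=> eq_e; apply: eq_bigr => b _; congr (_ * _).
  by apply: eq_bigr => i _; rewrite eq_e.
apply: (null_subset nullP) (null_zeros nullP (P := P) _ _).
- by move=> _ [v _ <-]; exact: rel.
- by exists d, c.
- by exists (of_entries e); rewrite (extP _ e) //; exact: of_entriesK.
Qed.

(** Failure of general position makes some maximal minor vanish, and no such
    minor vanishes identically. *)
Lemma null_not_general m (p : factors -> 'M[F]_(m, r))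
    (ix : 'I_m -> 'I_r -> index) :
  (m <= r)%N -> (forall AC i l, p AC i l = entry AC (ix i l)) ->
  (forall M, exists AC, p AC = M) ->
  null [set AC | ~ general_position (p AC)]%classic.
Proof.
move=> lemr pE p_surj.
apply: (null_subset nullP (T := [set AC | exists g : {ffun 'I_m -> 'I_r},
    injectiveb g /\ \det (colsub g (p AC)) = 0]%classic)).
  move=> AC /existsNP[x /not_implyP[x0 /negP]]; rewrite -leqNgt.
  move=> /exists_subset_card[S sS cS].
  pose g := [ffun i => @enum_val _ (mem S) (cast_ord (esym cS) i)].
  exists g; split.
    by apply/injectiveP => i j; rewrite !ffunE => /enum_val_inj/cast_ord_inj.
  apply/eqP; apply: contraT; rewrite -unitfE -unitmxE => unitg.
  case/eqP: x0; rewrite -[x](mulmxK unitg) mulmx_colsub.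
  rewrite (_ : colsub _ _ = 0) ?mul0mx //; apply/rowP => i; rewrite mxE [RHS]mxE.
  apply/eqP; have /(subsetP sS) : g i \in S by rewrite ffunE; exact: enum_valP.
  by rewrite inE.
apply: null_exists => g; apply: null_if => /injectiveP inj_g.
pose P (e : index -> F) := \det (\matrix_(i, j) e (ix i (g j))).
have PE AC : P (entry AC) = \det (colsub g (p AC)).
  by congr (\det _); apply/matrixP => i j; rewrite !mxE pE.
apply: (null_subset nullP) (null_zeros nullP (P := P) _ _) => /=.
- by move=> AC /=; rewrite PE.
- apply: polynomial_det => i j.
  by apply: polynomial_ext (polynomial_var F (ix i (g j))) => e; rewrite mxE.
have [AC pAC] := p_surj (\matrix_(i, l) (g i == l)%:R).
exists AC; rewrite PE pAC (_ : colsub _ _ = 1%:M) ?det1 ?oner_neq0 //.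
by apply/matrixP => i j; rewrite !mxE (inj_eq inj_g).
Qed.

(** ** Factors whose contraction drops rank *)

Section Parametrization.
Variables (q : nat) (i0 : 'I_n) (f : 'I_q -> 'I_n) (g : 'I_n -> 'I_r).

(** The parameters are the coordinates of [x] other than [x_{i0} = 1], the matrix
    [A], the columns of [C] off the image of [g], and the two factors of the
    contraction, of which the second one is the identity on the rows in the
    image of [f]. *)
Definition param : finType :=
  ({j : 'I_n | j != i0} + 'I_n * 'I_r + 'I_K * {l : 'I_r | l \notin codom g}
   + 'I_K * 'I_q + {i : 'I_n | i \notin codom f} * 'I_q)%type.

Definition direction (v : param -> F) : 'rV[F]_n :=
  \row_j (if insub j is Some s then v (inl (inl (inl (inl s)))) else 1).
Definition first_factor (v : param -> F) : 'M[F]_(n, r) :=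
  \matrix_(i, l) v (inl (inl (inl (inr (i, l))))).
Definition free_columns (v : param -> F) : 'M[F]_(K, r) :=
  \matrix_(k, l) (if insub l is Some s then v (inl (inl (inr (k, s)))) else 0).
Definition left_factor (v : param -> F) : 'M[F]_(K, q) :=
  \matrix_(k, t) v (inl (inr (k, t))).
Definition right_factor (v : param -> F) : 'M[F]_(n, q) :=
  \matrix_(i, t) (if insub i is Some s then v (inr (s, t)) else (f t == i)%:R).

Definition contraction_factor (v : param -> F) : 'M[F]_(n, r) :=
  first_factor v *m diag_mx (direction v *m first_factor v).

Definition pivot_block (v : param -> F) : 'M[F]_n :=
  rowsub g (contraction_factor v)^T.

(** The solution [C] of [C B^T = U V^T], with [B] the contraction factor, by
    Cramer's rule in the columns indexed by [g].  The other columns and [U] enter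
    multiplied by the determinant, which makes the formula polynomial. *)
Definition second_factor (v : param -> F) : 'M[F]_(K, r) :=
  \det (pivot_block v) *: free_columns v
  + (left_factor v *m (right_factor v)^T
     - free_columns v *m (contraction_factor v)^T)
    *m \adj (pivot_block v) *m (\matrix_(i, l) (g i == l)%:R).

Definition deficient_factors (v : param -> F) : factors :=
  (first_factor v, second_factor v).

Lemma polynomial_mx_var m k (M : (param -> F) -> 'M[F]_(m, k)) :
  (forall i j, (exists w, forall v, M v i j = v w) \/ exists c, forall v, M v i j = c) ->
  polynomial_mx M.
Proof.
move=> MP i j; have [[w /polynomial_ext]|[c /polynomial_ext]] := MP i j; apply.
- exact: polynomial_var.
- exact: polynomial_const.
Qed.

(** The hypothesis says that the matrices of rank [q] have codimension
    [(n - q) * (K - q) >= n], more than the [n - 1] coordinates of [x]. *)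
Lemma null_deficient_factors : injective f -> injective g ->
  (n <= r)%N -> (n + K * q + (n - q) * q <= K * n)%N ->
  null (range deficient_factors).
Proof.
move=> inj_f inj_g ler leq_codim.
have card_compl (T : finType) m (h : 'I_m -> T) : injective h ->
    #|{: {t : T | t \notin codom h}}| = (#|T| - m)%N.
  move=> inj_h; rewrite card_sig -[m in RHS](card_ord m) -(card_codom inj_h).
  by rewrite -[#|T|](cardC (mem (codom h))) addKn.
have pA : polynomial_mx first_factor.
  by apply: polynomial_mx_var => i l; left; eexists => v; rewrite mxE.
have pB : polynomial_mx contraction_factor.
  apply: polynomial_mxM => //; apply/polynomial_mx_diag/polynomial_mxM => //.
  apply: polynomial_mx_var => i j; case E: (insub j : option {j | j != i0}) => [s|].
    by left; eexists => v; rewrite mxE E.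
  by right; eexists => v; rewrite mxE E.
have pC : polynomial_mx free_columns.
  apply: polynomial_mx_var => k l.
  case E: (insub l : option {l | l \notin codom g}) => [s|].
    by left; eexists => v; rewrite mxE E.
  by right; eexists => v; rewrite mxE E.
apply: null_range => //.
  rewrite !card_sum !card_prod !card_ord !card_compl // !card_ord.
  rewrite card_sig (_ : #|_| = n.-1); last by rewrite cardC1 card_ord.
  have n0 : (0 < n)%N by case: (n) i0 => // -[].
  rewrite [(K * (r - n))%N]mulnBr; have : (K * n <= K * r)%N by rewrite leq_mul2l ler orbT.
  lia.
have pG : polynomial_mx pivot_block.
  by apply: polynomial_mx_sub; exact: polynomial_mx_tr.
apply: polynomial_mxD.
  by apply: polynomial_mxZ => //; exact: polynomial_det.
apply: polynomial_mxM; last by move=> i j; exact: polynomial_const.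
apply: polynomial_mxM; last exact: polynomial_mx_adj.
apply: polynomial_mxB.
  apply: polynomial_mxM; last apply: polynomial_mx_tr.
    by apply: polynomial_mx_var => k t; left; eexists => v; rewrite mxE.
  apply: polynomial_mx_var => i t.
  case E: (insub i : option {i | i \notin codom f}) => [s|].
    by left; eexists => v; rewrite mxE E.
  by right; eexists => v; rewrite mxE E.
by apply: polynomial_mxM => //; exact: polynomial_mx_tr.
Qed.

End Parametrization.

(** Scaling [x] makes one coordinate 1.  The contraction has rank [q], so [q] of
    its rows, indexed by [f], express the others; this is a factorization
    through [q] dimensions whose second factor is known at [f].  As [A] is in
    general position, [n] columns, indexed by [g], of the matrix multiplying
    [C] are independent, and Cramer's rule gives the columns of [C] at [g].
    Dividing the other parameters by the determinant in advance keeps the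
    parametrization polynomial. *)
Lemma deficient_factors_cover (A : 'M[F]_(n, r)) (C : 'M[F]_(K, r)) (x : 'rV[F]_n) :
  (0 < n)%N -> general_position A -> (n <= weight (x *m A))%N ->
  exists i0 (f : {ffun 'I_(\rank (A *m diag_mx (x *m A) *m C^T)) -> 'I_n})
    (g : {ffun 'I_n -> 'I_r}),
    [/\ injective f, injective g & range (@deficient_factors _ i0 f g) (A, C)].
Proof.
move=> n0 gpA wx.
have x0 : x != 0.
  apply: contraTneq wx => ->; rewrite mul0mx -ltnNge.
  rewrite [weight _](_ : _ = 0%N) //.
  by apply/eqP; rewrite cards_eq0; apply/eqP/setP => j; rewrite !inE mxE eqxx.
have [i0 xi0] := rV0Pn x x0.
pose y := (x 0 i0)^-1 *: x.
have yi0 : y 0 i0 = 1 by rewrite mxE mulVf.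
have diag_y : diag_mx (y *m A) = (x 0 i0)^-1 *: diag_mx (x *m A).
  by rewrite -scalemxAl linearZ.
have rank_y : \rank (A *m diag_mx (y *m A) *m C^T) = \rank (A *m diag_mx (x *m A) *m C^T).
  rewrite diag_y -scalemxAr -scalemxAl.
  by rewrite mxrank_scale_nz // invr_eq0.
have wy : (n <= weight (y *m A))%N.
  rewrite /weight (_ : zeros (y *m A) = zeros (x *m A)) //.
  by apply/setP => j; rewrite !inE -scalemxAl mxE mulf_eq0 invr_eq0 (negPf xi0).
rewrite -rank_y; set M := A *m diag_mx (y *m A) *m C^T.
pose B := A *m diag_mx (y *m A).
have fullB : row_full B^T.
  rewrite /row_full mxrank_tr -/(row_free B) -kermx_eq0; apply/eqP/row_matrixP => i; rewrite row0.
  set z := row i _; apply/eqP; apply: contraT => z0.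
  have zB : z *m B = 0 by apply/sub_kermxP; exact: row_sub.
  have := gpA z z0; rewrite ltnNge => /negP[]; apply: leq_trans wy _.
  apply: subset_leq_card; apply/subsetP => l; rewrite !inE => yl.
  move/rowP/(_ l): zB; rewrite mulmxA mul_mx_diag mxE [RHS]mxE => /eqP.
  by rewrite mulf_eq0 (negPf yl) orbF.
pose g := fullrankfun fullB; pose f := maxrankfun M.
have inj_f : injective f by exact: maxrankfun_inj.
have inj_g : injective g by exact: fullrankfun_inj.
exists i0, f, g; split=> //.
pose G := rowsub g B^T; have unitG : G \in unitmx by exact: fullrowsub_unit.
have detG : \det G != 0 by rewrite -unitfE -unitmxE.
pose R0 := rowsub f M; pose W := M *m pinvmx R0.
have WR : W *m R0 = M by rewrite mulmxKpV // eq_maxrowsub.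
have fW : rowsub f W = 1%:M by rewrite -mul_rowsub_mx mulmxVp ?maxrowsub_free.
pose v (w : param i0 f g) : F := match w with
  | inl (inl (inl (inl s))) => y 0 (val s)
  | inl (inl (inl (inr (i, l)))) => A i l
  | inl (inl (inr (k, s))) => (\det G)^-1 * C k (val s)
  | inl (inr (k, t)) => (\det G)^-1 * R0 t k
  | inr (s, t) => W (val s) t
  end.
exists v => //.
have vy : direction v = y.
  apply/rowP => j; rewrite mxE; case: insubP => [s _ <- //|].
  by rewrite negbK => /eqP ->.
have vA : first_factor v = A by apply/matrixP => i l; rewrite mxE.
have vB : contraction_factor v = B by rewrite /contraction_factor vA vy.
have vG : pivot_block v = G by rewrite /pivot_block vB.
have vL : left_factor v = (\det G)^-1 *: R0^T.
  by apply/matrixP => k t; rewrite mxE [RHS]mxE [X in _ = _ * X]mxE.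
have vW : right_factor v = W.
  apply/matrixP => i t; rewrite mxE; case: insubP => [s _ <- //|].
  rewrite negbK => /codomP[t' ->]; rewrite (inj_eq inj_f) eq_sym.
  by move/matrixP/(_ t' t): fW; rewrite mxE [RHS]mxE eq_sym => ->.
rewrite /deficient_factors vA; congr (_, _).
rewrite /second_factor vG vL vW vB -scalemxAl -trmx_mul WR.
pose E := \matrix_(i < n, l < r) (g i == l)%:R : 'M[F]_(n, r).
rewrite -/E; set C' := free_columns v.
have CE : C = \det G *: C' + colsub g C *m E.
  apply/matrixP => k l; rewrite !mxE.
  case: insubP => [s lg sl|].
    have -> : v (inl (inl (inr (k, s)))) = (\det G)^-1 * C k l by rewrite -sl.
    rewrite mulVKf // big1 ?addr0 // => i _; rewrite !mxE.
    by case: eqP lg => [<-|]; rewrite ?mulr0 // codom_f.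
  rewrite negbK => /codomP[i ->]; rewrite mulr0 add0r (bigD1 i) //= !mxE eqxx mulr1.
  by rewrite big1 ?addr0 // => j ji; rewrite !mxE (inj_eq inj_g) (negPf ji) mulr0.
have EB : E *m B^T = G.
  rewrite (_ : E = rowsub g 1%:M) ?mul_rowsub_mx ?mul1mx //.
  by apply/matrixP => i l; rewrite !mxE.
have MT : M^T = C *m B^T by rewrite /M trmx_mul trmxK.
have X : (\det G)^-1 *: M^T - C' *m B^T = (\det G)^-1 *: (colsub g C *m G).
  rewrite MT {1}CE mulmxDl -scalemxAl -mulmxA EB scalerDr scalerA mulVf //.
  by rewrite scale1r addrAC subrr add0r.
rewrite [RHS]CE X -scalemxAl -mulmxA mul_mx_adj mul_mx_scalar scalerA mulVf //.
by rewrite scale1r.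
Qed.

Theorem null_non_unique_factors :
  (1 < n)%N -> (n <= r)%N -> (K <= n)%N -> ((r - n).+2 <= K)%N ->
  (n <= (n - (r - n).+1) * (K - (r - n).+1))%N ->
  null (@non_unique_factors F n K r).
Proof.
move=> n1 ler leKn lemK codim.
pose deficient := [set AC : factors | exists (q : 'I_(r - n).+2) i0
  (f : {ffun 'I_q -> 'I_n}) (g : {ffun 'I_n -> 'I_r}),
  (injectiveb f && injectiveb g) /\ range (@deficient_factors _ i0 f g) AC]%classic.
apply: (null_subset nullP (T := [set AC | ~ general_position AC.1]%classic `|`
  ([set AC | ~ general_position AC.2]%classic `|` deficient))%classic).
  move=> [A C] /= nonuniq; apply: contrapT => /not_orP[/contrapT gpA].
  move=> /not_orP[/contrapT gpC Ndef]; apply: nonuniq.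
  apply: SFS_CPD_unique_polyadic => // x wx.
  rewrite leqNgt; apply/negP => ltq; apply: Ndef.
  have [|i0 [f [g [inj_f inj_g rangeAC]]]] := deficient_factors_cover C _ gpA wx.
    exact: ltnW.
  exists (Ordinal ltq), i0, f, g; split=> //.
  by apply/andP; split; exact/injectiveP.
apply: (null_union nullP).
  apply: (null_not_general (p := fst) (ix := fun i l => inl (i, l))) => //.
  by move=> A; exists (A, 0).
apply: (null_union nullP).
  apply: (null_not_general (p := snd) (ix := fun i l => inr (i, l))) => //.
  - exact: leq_trans ler.
  - by move=> C; exists (0, C).
apply: null_exists => q; apply: null_exists => i0.
apply: null_exists => f; apply: null_exists => g.
apply: null_if => /andP[/injectiveP inj_f /injectiveP inj_g].
apply: null_deficient_factors => //.
(* Smaller ranks have larger codimension. *)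
have : (n <= (n - q) * (K - q))%N.
  by apply: leq_trans codim _; apply: leq_mul; apply: leq_sub2l; rewrite -ltnS.
have : (q <= K)%N by have := ltn_ord q; lia.
have : (q <= n)%N by have := ltn_ord q; lia.
nia.
Qed.

End ExceptionalFactors.

(** * Zero sets of polynomials are null *)

Lemma polynomial_slice (F : fieldType) (V : finType) (P : (V -> F) -> F)
    (s : V -> option F) :
  polynomial P -> exists p : {poly F}, forall z, P (fun i => odflt z (s i)) = p.[z].
Proof.
move=> [d [c Pc]].
exists (\sum_a (c a)%:P * \prod_i (oapp polyC 'X (s i)) ^+ a i).
move=> z; rewrite Pc horner_sum; apply: eq_bigr => a _.
rewrite hornerM hornerC horner_prod; congr (_ * _); apply: eq_bigr => i _.
by rewrite horner_exp; case: (s i) => [b|]; rewrite /= ?hornerC ?hornerX.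
Qed.

Section NullZeros.
Import classical_sets.
Local Open Scope classical_set_scope.
(** Real and imaginary parts in [R[i]] express measurability of [F]-valued maps
    for [F] the real and the complex numbers alike. *)
Context (R : realType) (F : fieldType) (iota : {rmorphism F -> R[i]}).

Definition measurable_scalar d (X : measurableType d) (h : X -> F) :=
  measurable_fun setT (fun x => complex.Re (iota (h x))) /\
  measurable_fun setT (fun x => complex.Im (iota (h x))).

Section Closure.
Context d (X : measurableType d).

Lemma measurable_scalar_const c : measurable_scalar (fun _ : X => c).
Proof. by split; exact: measurable_cst. Qed.

Lemma measurable_scalarD (g h : X -> F) : measurable_scalar g ->
  measurable_scalar h -> measurable_scalar (fun x => g x + h x).
Proof.
move=> [g1 g2] [h1 h2]; split.
- apply: (eq_measurable_fun _ _ (measurable_funD g1 h1)) => x _ /=.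
  by rewrite rmorphD; case: (iota _) (iota _) => [? ?] [].
- apply: (eq_measurable_fun _ _ (measurable_funD g2 h2)) => x _ /=.
  by rewrite rmorphD; case: (iota _) (iota _) => [? ?] [].
Qed.

Lemma measurable_scalarM (g h : X -> F) : measurable_scalar g ->
  measurable_scalar h -> measurable_scalar (fun x => g x * h x).
Proof.
move=> [g1 g2] [h1 h2]; split.
- apply: (eq_measurable_fun _ _ (measurable_funB (measurable_funM g1 h1)
    (measurable_funM g2 h2))) => x _ /=.
  by rewrite rmorphM; case: (iota _) (iota _) => [? ?] [].
- apply: (eq_measurable_fun _ _ (measurable_funD (measurable_funM g1 h2)
    (measurable_funM g2 h1))) => x _ /=.
  by rewrite rmorphM; case: (iota _) (iota _) => [? ?] [].
Qed.

Lemma measurable_scalar_sum (I : Type) (s : seq I) (h : I -> X -> F) :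
  (forall i, measurable_scalar (h i)) ->
  measurable_scalar (fun x => \sum_(i <- s) h i x).
Proof.
move=> mh; elim: s => [|i s IHs].
  rewrite (_ : (fun _ => _) = fun=> 0); first exact: measurable_scalar_const.
  by apply/funext => x; rewrite big_nil.
rewrite (_ : (fun _ => _) = fun x => h i x + \sum_(i <- s) h i x).
  exact: measurable_scalarD.
by apply/funext => x; rewrite big_cons.
Qed.

Lemma measurable_scalar_prod (I : Type) (s : seq I) (h : I -> X -> F) :
  (forall i, measurable_scalar (h i)) ->
  measurable_scalar (fun x => \prod_(i <- s) h i x).
Proof.
move=> mh; elim: s => [|i s IHs].
  rewrite (_ : (fun _ => _) = fun=> 1); first exact: measurable_scalar_const.
  by apply/funext => x; rewrite big_nil.
rewrite (_ : (fun _ => _) = fun x => h i x * \prod_(i <- s) h i x).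
  exact: measurable_scalarM.
by apply/funext => x; rewrite big_cons.
Qed.

Lemma measurable_scalarX (h : X -> F) k : measurable_scalar h ->
  measurable_scalar (fun x => h x ^+ k).
Proof.
move=> mh; elim: k => [|k IHk]; first exact: measurable_scalar_const.
by under eq_fun do rewrite exprS; exact: measurable_scalarM.
Qed.

Lemma measurable_scalar_polynomial (V : finType) (P : (V -> F) -> F)
    (h : X -> V -> F) :
  polynomial P -> (forall i, measurable_scalar (h ^~ i)) ->
  measurable_scalar (fun x => P (h x)).
Proof.
move=> [e [c Pc]] mh; rewrite (_ : (fun x => P (h x)) =
  fun x => \sum_a c a * monomial a (h x)); last by apply/funext => x.
apply: measurable_scalar_sum => a; apply: measurable_scalarM.
  exact: measurable_scalar_const.
by apply: measurable_scalar_prod => i; exact: measurable_scalarX.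
Qed.

Lemma measurable_zeros (h : X -> F) : measurable_scalar h ->
  measurable [set x | h x = 0].
Proof.
move=> [h1 h2]; rewrite (_ : mkset _ =
    (fun x => complex.Re (iota (h x))) @^-1` [set 0] `&`
    (fun x => complex.Im (iota (h x))) @^-1` [set 0]).
  by apply: measurableI; rewrite -[X in measurable X]setTI; [apply: h1|apply: h2].
apply/seteqP; split=> x /= [].
  by move=> ->; rewrite rmorph0.
move=> hx1 hx2; apply: (fmorph_inj iota); rewrite rmorph0.
by apply/eqP; rewrite eq_complex hx1 hx2 !eqxx.
Qed.
End Closure.

Context d (T : measurableType d) (mu : {sigma_finite_measure set T -> \bar R}).
Variable f : T -> F.
Hypotheses (mf : measurable_scalar f).
Hypothesis fiber0 : forall z, mu.-negligible (f @^-1` [set z]).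

(** A root is split off; its fiber is negligible and the quotient has smaller
    degree. *)
Lemma negligible_poly_zeros (p : {poly F}) : p != 0 ->
  mu.-negligible [set t | p.[f t] = 0].
Proof.
have [m] := ubnP (size p); elim: m p => // m IHm p ltpm p0.
have [[z pz]|Nroot] := pselect (exists z, root p z); last first.
  apply: (@negligibleS _ _ _ _ set0) => [t pt|].
    by case: Nroot; exists (f t); exact/rootP.
  exact: negligible_set0.
have [q pq] := factor_theorem _ _ pz.
have q0 : q != 0 by apply: contra_neq p0 => q0; rewrite pq q0 mul0r.
apply: (negligibleS _ (negligibleU (IHm q _ q0) (fiber0 z))).
- move=> t /= /eqP; rewrite pq hornerM mulf_eq0 hornerXsubC subr_eq0.
  by move=> /orP[/eqP|/eqP]; [left|right].
- by move: ltpm; rewrite pq size_Mmonic ?monicXsubC // size_XsubC addn2.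
Qed.

Lemma measurable_polynomial_zeros n (P : ('I_n -> F) -> F) : polynomial P ->
  measurable [set x : n.-tuple T | P (fun i => f (tnth x i)) = 0].
Proof.
move=> polyP; apply: measurable_zeros.
apply: (measurable_scalar_polynomial (h := fun x i => f (tnth x i))) => // i.
case: mf => m1 m2.
by split; [apply: (measurableT_comp m1)|apply: (measurableT_comp m2)];
  exact: measurable_tnth.
Qed.

(** By Fubini: fixing all coordinates but the first as in [v0] gives a nonzero
    polynomial in one variable, and over each value of the first coordinate that
    is not a zero of it the slice is the zero set of a polynomial in the other
    coordinates which does not vanish identically. *)
Theorem power_measure_zeros n (P : ('I_n -> F) -> F) v0 :
  polynomial P -> P v0 != 0 ->
  power_measure mu n [set x | P (fun i => f (tnth x i)) = 0] = 0%E.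
Proof.
elim: n P v0 => [|n IHn] P v0 polyP P0.
  rewrite (_ : mkset _ = set0) ?measure0 //.
  apply/seteqP; split=> // x /= Px; case/eqP: P0; rewrite -Px; congr P.
  by apply/funext => -[].
pose e t v : 'I_n.+1 -> F := fun i => odflt t (omap v (unlift ord0 i)).
pose Z := [set x : n.+1.-tuple T | P (fun i => f (tnth x i)) = 0].
have [p pP] := polynomial_slice (fun i => omap (v0 \o lift ord0) (unlift ord0 i)) polyP.
have p0 : p != 0.
  apply: contra_neq P0 => p0; transitivity (p.[v0 ord0]); last by rewrite p0 horner0.
  rewrite -pP; congr P; apply/funext => i.
  by case: (unliftP ord0 i) => [j ->|->].
rewrite [LHS]/= /cons_measure /pushforward -/Z.
pose Z' := (@cons_pair _ T n @^-1` Z).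
have mZ' : measurable Z'.
  by rewrite -[X in measurable X]setTI; apply: measurable_cons_pair => //; exact: measurable_polynomial_zeros.
rewrite -/Z' /product_measure1.
rewrite (@ge0_ae_eq_integral _ _ _ mu setT _ (cst 0%E)) //.
- exact: integral0_eq.
- exact: (measurable_fun_xsection (power_measure mu n) mZ').
apply: negligibleS (negligible_poly_zeros p0) => t /= NZ; apply: contrapT => pt.
apply: NZ => _.
have := IHn (fun v => P (e (f t) v)) (v0 \o lift ord0).
rewrite /e pP => <- //; last first.
- exact/eqP.
- apply: (polynomial_comp (g := fun i v => odflt (f t) (omap v (unlift ord0 i)))) => // i.
  by case: unliftP => [j _|_]; [exact: polynomial_var|exact: polynomial_const].
congr (power_measure mu n _); apply/funext => y; apply/propext.
rewrite /xsection /= in_setE /Z' /Z /=.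
suff -> : (fun i => f (tnth (cons_pair (t, y)) i)) =
  fun i => odflt (f t) (omap (fun j => f (tnth y j)) (unlift ord0 i)) by [].
by apply/funext => i; case: unliftP => [j ->|->]; rewrite ?tnthS ?tnth0.
Qed.
Lemma matrix_pair_null_ideal n K r :
  null_ideal (fun S : set ('M[F]_(n, r) * 'M[F]_(K, r)) =>
    (power_measure mu (n * r + K * r)).-negligible (matrix_pair f @^-1` S)).
Proof.
split=> [S S' SS'|S S' nS nS'|P polyP [[A C] PAC]].
- by apply: negligibleS; exact: preimage_subset.
- by rewrite preimage_setU; exact: negligibleU.
pose ix (w : 'I_n * 'I_r + 'I_K * 'I_r) : 'I_(n * r + K * r) := match w with
  | inl (i, l) => lshift (K * r) (mxvec_index i l)
  | inr (k, l) => rshift (n * r) (mxvec_index k l) end.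
pose Q (v : 'I_(n * r + K * r) -> F) := P (fun w => v (ix w)).
have polyQ : polynomial Q.
  by apply: (polynomial_comp (g := fun w v => v (ix w))) => // w; exact: polynomial_var.
rewrite (_ : _ @^-1` _ = [set x | Q (fun i => f (tnth x i)) = 0]).
  apply/negligibleP; first exact: measurable_polynomial_zeros.
  apply: (power_measure_zeros (v0 := row_mx (mxvec A) (mxvec C) 0)) => //.
  rewrite /Q (_ : (fun w => _) = entry (A, C)) //.
  by apply/funext => -[[i l]|[i l]] /=; rewrite ?row_mxEl ?row_mxEr mxvecE.
apply/funext => x; apply/propext; rewrite /= /Q.
suff -> : entry (matrix_pair f x) = fun w => f (tnth x (ix w)) by [].
by apply/funext => -[[i l]|[i l]] /=; rewrite mxE.
Qed.

End NullZeros.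

(** * Generic uniqueness over the real and the complex numbers *)

Section RealComplex.
Import classical_sets.
Local Open Scope classical_set_scope.
Variable R : realType.

Lemma real_null_ideal n K r : null_ideal (@real_null_set R n K r).
Proof.
apply: (@matrix_pair_null_ideal R R (real_complex R)) => [|z].
  by split; [exact: measurable_id|exact: measurable_cst].
apply/negligibleP; last exact: lebesgue_measure_set1.
exact: measurable_set1.
Qed.

Lemma complex_null_ideal n K r : null_ideal (@complex_null_set R n K r).
Proof.
apply: (@matrix_pair_null_ideal R R[i] idfun) => [|z].
  by split; exact: measurable_tnth.
pose B (i : 'I_2) : set (measurableTypeR R) :=
  [set if i == 0 then complex.Re z else complex.Im z].
have mB i : measurable (B i) by exact: measurable_set1.
rewrite (_ : _ @^-1` _ = [set x | forall i, B i (tnth x i)]).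
  apply/negligibleP; first exact: measurable_box.
  apply: eq_trans (power_measure_box _ mB) _.
  rewrite big_ord_recl [X in (X * _)%E](_ : _ = 0%E) ?mul0e //.
  exact: lebesgue_measure_set1.
apply/seteqP; split=> x /=.
  by move=> xz i; rewrite /B -xz /=; case: i => -[|[|//]] i2 /=; congr (tnth x _); exact: val_inj.
move=> Bx; have := Bx 0; have := Bx 1; rewrite /B /= /complex_of_pair => -> ->.
by case: (z).
Qed.

End RealComplex.

(** * The two forms of the bound *)

Section Bounds.
Variable R : realType.

Lemma sqrtr_intr_le (a b : int) : 0 <= a ->
  (Num.sqrt (a%:~R : R) <= b%:~R) = (0 <= b) && (a <= b ^+ 2).
Proof.
move=> a0; apply/idP/andP => [leab|[b0 leab]].
  have b0 : 0 <= b%:~R :> R by exact: le_trans (sqrtr_ge0 _) leab.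
  split; first by rewrite -(ler0z R).
  rewrite -(ler_int R) -[leLHS]sqr_sqrtr ?ler0z // rmorphXn /=.
  by rewrite lerXn2r ?nnegrE ?sqrtr_ge0.
have b0' : 0 <= b%:~R :> R by rewrite ler0z.
rewrite -(ger0_norm b0') -sqrtr_sqr ler_wsqrtr // -rmorphXn /= ler_int //.
Qed.

Lemma sqrt_boundE (I K r : nat) : (0 < I)%N ->
  sqrt_bound R I K r <->
  [/\ (2 <= K)%N, (K <= I)%N, (I <= r)%N &
    (0 <= K%:Z + 3 * I%:Z - 1 - 2 * r%:Z) &&
    ((K%:Z - I%:Z) ^+ 2 + 2 * K%:Z + 6 * I%:Z - 3 <=
     (K%:Z + 3 * I%:Z - 1 - 2 * r%:Z) ^+ 2)].
Proof.
move=> I0; rewrite /sqrt_bound -sqrtr_intr_le; last by nia.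
rewrite ler_pdivlMr // lerBrDl -lerBrDr.
rewrite (_ : _ ^+ 2 + 2 * K%:R + 6 * I%:R - 3 =
  ((K%:Z - I%:Z) ^+ 2 + 2 * K%:Z + 6 * I%:Z - 3)%:~R); last first.
  by rewrite !(rmorphD, rmorphN, rmorphXn, rmorphM) /= !pmulrn; ring.
rewrite (_ : K%:R + 3 * I%:R - 1 - r%:R * 2 =
  (K%:Z + 3 * I%:Z - 1 - 2 * r%:Z)%:~R) //.
by rewrite !(rmorphD, rmorphN, rmorphXn, rmorphM) /= !pmulrn; ring.
Qed.

(** With [s = K + 3 I - 1] and [D] the radicand,
    [(s - 2 r)^2 - D = 4 ((2 I - 1 - r) (K + I - 1 - r) - r)], so the two forms
    agree up to the root of the quadratic below which [r] lies.  The conditions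
    [s - 2 r >= 0] and [r <= K + I - 1] both select the smaller one. *)
Lemma sqrt_bound_product_bound (I K r : nat) : (0 < I)%N ->
  sqrt_bound R I K r <-> product_bound I K r.
Proof.
move=> I0; rewrite (sqrt_boundE _ _ I0) /product_bound; split.
  case=> K2 leKI leIr /andP[s0 leD]; split=> //; last by nia.
  have leP : 0 <= (2 * I%:Z - 1 - r%:Z) * (K%:Z + I%:Z - 1 - r%:Z) - r%:Z by nia.
  rewrite leNgt; apply/negP => ltKm.
  have neg2 : K%:Z + I%:Z - 1 - r%:Z <= 0 by lia.
  have pos1 : 0 <= 2 * I%:Z - 1 - r%:Z by lia.
  have := mulr_ge0_le0 pos1 neg2; lia.
case=> lemK leKI leIr leP; split=> //; first by nia.
apply/andP; split; [by lia | by nia].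
Qed.

Lemma product_bound_nat (I K r : nat) : (0 < I)%N -> product_bound I K r ->
  [/\ (1 < I)%N, (I <= r)%N, (K <= I)%N, ((r - I).+2 <= K)%N &
      (I <= (I - (r - I).+1) * (K - (r - I).+1))%N].
Proof.
move=> I0 [lemK leKI leIr leP].
have lemK' : ((r - I).+2 <= K)%N by nia.
split=> //; first by lia.
have eI : I%:Z + 1 - (r%:Z - I%:Z + 2) = (I - (r - I).+1)%:Z by lia.
have eK : K%:Z + 1 - (r%:Z - I%:Z + 2) = (K - (r - I).+1)%:Z by lia.
by move: leP; rewrite eI eK -PoszM lez_nat; exact: leq_trans.
Qed.

End Bounds.

Theorem proposition1p13 (R : realType) (I K r : nat)
    (I_gt0 : (0 < I)%N) (K_gt0 : (0 < K)%N) (r_gt0 : (0 < r)%N) :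
  (sqrt_bound R I K r <-> product_bound I K r) /\
  (sqrt_bound R I K r ->
   real_generically_unique R I K r /\ complex_generically_unique R I K r).
Proof.
have boundE := sqrt_bound_product_bound R K r I_gt0.
split=> // /boundE/(product_bound_nat I_gt0)[I1 leIr leKI lemK codim].
by split; [apply: (null_non_unique_factors _ (real_null_ideal R I K r))
  | apply: (null_non_unique_factors _ (complex_null_ideal R I K r))] => // k;
  rewrite pnatr_eq0.
Qed.
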